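(* For every symmetric convex body $K\subset\mathbb{R}^2$, $$\mathcal{C}(K)\ \geq\ \mathcal{C}([-1,1]^2)=144.$$
   Context: A convex body in $\mathbb{R}^n$ is a compact convex set with nonempty interior; $K$ is symmetric if $K=-K$; $|K|$ is Lebesgue measure. The covariance matrix $\mathrm{Cov}(K)$ is the $n\times n$ matrix with entries $\mathrm{Cov}(K)_{ij}=\int_K x_ix_j\frac{dx}{|K|}-\int_K x_i\frac{dx}{|K|}\int_K x_j\frac{dx}{|K|}$, and $\mathcal{C}(K)=\frac{|K|^2}{\det\mathrm{Cov}(K)}$. *)

(* Defs.v *)
From HB Require Import structures.
From mathcomp Require Import all_boot all_order all_algebra.
From mathcomp Require Import all_classical all_reals all_analysis.

Set Implicit Arguments.
Unset Strict Implicit.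
Unset Printing Implicit Defensive.

Import Order.TTheory GRing.Theory Num.Theory.
Import numFieldNormedType.Exports.

Local Open Scope classical_set_scope.
Local Open Scope ring_scope.

Definition convex_body (R : realType) (E : normedModType R) (K : set E) : Prop :=
  [/\ compact K, @convex_set R E K & K° !=set0].

Definition symmetric_set (R : realType) (E : normedModType R) (K : set E) : Prop :=
  K = [set - x | x in K].

(* The plane is R * R: its product topology is the Euclidean one, and the
   product of two copies of the (Borel) Lebesgue measure of the line is the
   Lebesgue measure of the plane on Borel sets, hence on all convex bodies. *)
Section plane.
Variable R : realType.

Definition lebesgue_measure2 := (@lebesgue_measure R \x @lebesgue_measure R)%E.

Implicit Types (K : set (R * R)) (i j : 'I_2) (x : R * R).

Definition area K : R := fine (lebesgue_measure2 K).

(* Integral of f against the normalized measure dx/|K| on K. *)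
Definition average K (f : R * R -> R) : R :=
  (\int[lebesgue_measure2]_(x in K) f x) / area K.

Definition coord2 i x : R := if i == ord0 then x.1 else x.2.

Definition Cov K : 'M[R]_2 :=
  \matrix_(i, j) (average K (fun x => coord2 i x * coord2 j x)
                  - average K (coord2 i) * average K (coord2 j)).

Definition calC K : R := area K ^+ 2 / \det (Cov K).

End plane.

(* Main.v *)
Require Import Defs.
From HB Require Import structures.
From mathcomp Require Import all_boot all_order all_algebra.
From mathcomp Require Import all_classical all_reals all_analysis.
From mathcomp Require Import measurable_realfun ring lra.

Set Implicit Arguments.
Unset Strict Implicit.
Unset Printing Implicit Defensive.

Import Order.TTheory GRing.Theory Num.Theory.
Import numFieldNormedType.Exports.

Local Open Scope classical_set_scope.
Local Open Scope ring_scope.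

(** For a centred body, [calC K = area K ^+ 4 / (M11 * M22 - M12 ^+ 2)], where
    the [Mij] are the second moments [\int_K x_i x_j]; this quantity does not
    change under invertible linear maps ([calC_linear]).  So [K] may be put in a
    normal position: if [x, y] maximize the determinant on [K * K], the linear
    map sending [x, y] to the corners [(1, 1), (-1, 1)] turns [K] into a body
    that contains the square [[-1, 1]^2], by convexity, and lies in the diamond
    [|u| + |v| <= 2], by maximality ([normal_position]).  Both the square and
    the diamond are parallelograms, hence extremal.

    A body in this position is the square plus four caps, one on each side; let
    [2 * A] be the area of the top and bottom caps and [2 * B] that of the left
    and right ones, so that [area K = 4 + 2 * A + 2 * B].  By Fubini,
    [\int_K u^2] is the integral of [u^2 * X u], where [X u] is the length of the
    vertical slice at [u], a linear functional of [X].  On [[0, 1]], [X] is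
    nonincreasing and at most [4 - 2 * u]; on [[1, 2]] it starts at [2] and is
    concave on its support.  Among the profiles with these properties and with
    prescribed integrals [2 + A] and [B], the second moment is maximal for the
    constant cut off by the line [4 - 2 * u] ([inner_profile]) and for the linear
    profile that decreases from [2] to [0] ([outer_profile]): in both cases the
    difference with the extremal profile changes sign only once, from plus to
    minus, along [u] ([single_crossing]).  This gives
    [3 * M11 <= 4 + 6 * B + 4 * B^2 + B^3 + 2 * A - A^2] ([moment_bound]), and the
    same bound for [M22] with [A] and [B] exchanged.

    It remains to bound [M11 * M22 - M12 ^+ 2] by [M11 * M22] and to check a
    polynomial inequality in [A, B] on the unit square ([cap_area_inequality]),
    in which equality holds at [A = B = 0] (the square) and [A = B = 1] (the
    diamond). *)

(** * Linear changes of variables in the plane *)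

Section change_of_variables.
Variable R : realType.
Local Notation line := (measurableTypeR R).
Local Notation plane := (line * line)%type.
Local Notation leb := (@lebesgue_measure R).
Local Notation leb2 := (@lebesgue_measure2 R).

Lemma lebesgue_measure_affine (a b : R) (A : set line) : a != 0 ->
  measurable A ->
  (`|a|%:E * leb ((fun x : R => (a * x + b)%R) @^-1` A) = leb A)%E.
Proof.
move=> a0 mA.
pose phi := (fun x : line => a * x + b : line).
have mphi : measurable_fun setT phi.
  by apply: measurable_funD => //; apply: measurable_funM.
pose k : {nonneg R} := NngNum (normr_ge0 a).
pose m : measure line R := mscale k (pushforward leb phi).
suff -> : leb A = m mphi A by [].
apply: lebesgue_measure_unique => // _ [[c d] _ <-] /=.
rewrite /mscale/=.
have [cd|dc] := ltP c d; last first.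
  rewrite set_itv_ge ?bnd_simp -?leNgt//.
  by rewrite /pushforward preimage_set0 !measure0 mule0.
rewrite lebesgue_measure_itv/= lte_fin cd /pushforward.
move: a0; rewrite neq_lt => /orP[a0|a0].
- have -> : phi @^-1` `]c, d]%classic = `[(d - b) / a, (c - b) / a[%classic.
    apply/seteqP; split => x; rewrite /= !in_itv/= /phi.
      move=> /andP[h1 h2]; rewrite ler_ndivrMr// ltr_ndivlMr//.
      by apply/andP; split; lra.
    rewrite ler_ndivrMr// ltr_ndivlMr// => /andP[h1 h2].
    by apply/andP; split; lra.
  rewrite lebesgue_measure_itv/= lte_fin.
  rewrite ltr_ndivlMr// divfK ?lt_eqF// ltrD2r cd.
  by rewrite ltr0_norm//= -!EFinB -EFinM; congr EFin; field; rewrite lt_eqF.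
- have -> : phi @^-1` `]c, d]%classic = `](c - b) / a, (d - b) / a]%classic.
    apply/seteqP; split => x; rewrite /= !in_itv/= /phi.
      move=> /andP[h1 h2]; rewrite ler_pdivlMr// ltr_pdivrMr//.
      by apply/andP; split; lra.
    rewrite ler_pdivlMr// ltr_pdivrMr// => /andP[h1 h2].
    by apply/andP; split; lra.
  rewrite lebesgue_measure_itv/= lte_fin.
  rewrite ltr_pdivrMr// divfK ?gt_eqF// ltrD2r cd.
  by rewrite gtr0_norm//= -!EFinB -EFinM; congr EFin; field; rewrite gt_eqF.
Qed.

(** Stating the factor on the side of the preimage makes it multiplicative under
    composition and avoids inverse maps. *)
Definition scales_area (phi : plane -> plane) (c : R) :=
  [/\ measurable_fun setT phi, 0 < c &
    forall A : set plane, measurable A ->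
      (c%:E * leb2 (phi @^-1` A) = leb2 A)%E].

Lemma scales_area_comp phi psi c d :
  scales_area phi c -> scales_area psi d -> scales_area (phi \o psi) (c * d).
Proof.
move=> [mphi c0 phiE] [mpsi d0 psiE]; split.
- exact: measurableT_comp.
- exact: mulr_gt0.
- move=> A mA; rewrite EFinM -muleA comp_preimage psiE ?phiE//.
  by rewrite -[X in measurable X]setTI; exact: mphi.
Qed.

Let shear_snd (s : R) : scales_area (fun x : plane => (x.1, s * x.1 + x.2)) 1.
Proof.
split => //.
  apply: measurable_fun_pair => //.
  apply: measurable_funD => //.
  by apply: measurable_funM => //.
move=> A mA; rewrite mul1e.
apply: eq_integral => x _ /=.
rewrite !xsectionE -[RHS](@lebesgue_measure_affine 1 (s * x))//; last first.
  by rewrite -xsectionE; exact: measurable_xsection.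
rewrite normr1 mul1e; congr (leb _).
by apply/seteqP; split => y /=; rewrite mul1r addrC.
Qed.

Let shear_fst (s : R) : scales_area (fun x : plane => (x.1 + s * x.2, x.2)) 1.
Proof.
split => //.
  apply: measurable_fun_pair => //.
  apply: measurable_funD => //.
  by apply: measurable_funM => //.
have E (A : set plane) : measurable A -> leb2 A = (leb \x^ leb)%E A.
  by apply: product_measure_unique => B C mB mC; exact: product_measure2E.
move=> A mA; rewrite mul1e.
have mphi : measurable_fun setT (fun x : plane => (x.1 + s * x.2, x.2) : plane).
  apply: measurable_fun_pair => //.
  by apply: measurable_funD => //; apply: measurable_funM.
rewrite !E//; last by rewrite -[X in measurable X]setTI; exact: mphi.
apply: eq_integral => y _ /=.
rewrite !ysectionE -[RHS](@lebesgue_measure_affine 1 (s * y))//; last first.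
  by rewrite -ysectionE; exact: measurable_ysection.
rewrite normr1 mul1e; congr (leb _).
by apply/seteqP; split => x /=; rewrite mul1r.
Qed.

Let dilation (a b : R) : a != 0 -> b != 0 ->
  scales_area (fun x : plane => (a * x.1, b * x.2)) (`|a| * `|b|).
Proof.
move=> a0 b0.
pose phi := (fun x : plane => (a * x.1, b * x.2) : plane).
have mphi : measurable_fun setT phi.
  by apply: measurable_fun_pair => //; apply: measurable_funM.
split => //; first by rewrite mulr_gt0// normr_gt0.
move=> A mA.
pose k : {nonneg R} := NngNum (mulr_ge0 (normr_ge0 a) (normr_ge0 b)).
pose m : measure plane R := mscale k (pushforward leb2 phi).
suff -> : leb2 A = m mphi A by [].
apply: product_measure_unique => // B C mB mC.
rewrite [LHS](_ : _ = (`|a| * `|b|)%:E * leb2 (phi @^-1` (B `*` C)))%E//.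
have -> : phi @^-1` (B `*` C) =
  ((fun x => a * x + 0) @^-1` B) `*` ((fun x => b * x + 0) @^-1` C).
  by apply/seteqP; split => -[x y] /=; rewrite !addr0.
have mpre c (D : set line) : measurable D ->
    measurable ((fun x => c * x + 0 : line) @^-1` D : set line).
  move=> mD; rewrite -[X in measurable X]setTI.
  have mf : measurable_fun setT (fun x => c * x + 0 : line).
    by apply: measurable_funD => //; apply: measurable_funM.
  exact: mf.
rewrite [lebesgue_measure2 _]product_measure1E//; [|exact: mpre|exact: mpre].
rewrite -[X in _ = (X * _)%E](lebesgue_measure_affine 0 a0 mB).
rewrite -[X in _ = (_ * X)%E](lebesgue_measure_affine 0 b0 mC).
by rewrite EFinM muleACA.
Qed.

(** Gauss elimination: a matrix with a nonzero first entry is a product of two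
    shears and a dilation.  Shears translate each slice, and dilations scale
    rectangles. *)
Lemma linear_scales_area (a b c d : R) : a * d - b * c != 0 ->
  scales_area (fun x : plane => (a * x.1 + b * x.2, c * x.1 + d * x.2))
    `|a * d - b * c|.
Proof.
have pivot (a' b' c' d' : R) : a' != 0 -> a' * d' - b' * c' != 0 ->
    scales_area (fun x : plane => (a' * x.1 + b' * x.2, c' * x.1 + d' * x.2))
    `|a' * d' - b' * c'|.
  move=> a0 D0.
  have D0' : (a' * d' - b' * c') / a' != 0 by rewrite mulf_neq0// invr_neq0.
  have := scales_area_comp (shear_snd (c' / a'))
    (scales_area_comp (dilation a0 D0') (shear_fst (b' / a'))).
  rewrite mul1r mulr1 -normrM mulrCA divff// mulr1.
  congr (scales_area _ _); apply/funext => -[x y] /=.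
  by congr pair; field.
have [->|a0] := eqVneq a 0; last exact: pivot.
rewrite mul0r sub0r => D0.
(* Adding the second row to the first produces a nonzero pivot. *)
have c0 : c != 0 by apply: contra_neq D0 => ->; rewrite mulr0 oppr0.
have := scales_area_comp (shear_fst (- 1)) (@pivot c (b + d) c d c0 _).
rewrite (_ : c * d - (b + d) * c = - (b * c)); last by ring.
rewrite mul1r => /(_ D0).
congr (scales_area _ _); apply/funext => -[x y] /=.
by congr pair; ring.
Qed.

Lemma integral_scales_area phi c (D : set plane) (f : plane -> R) :
  scales_area phi c -> measurable D -> measurable_fun setT f ->
  leb2.-integrable (phi @^-1` D) (EFin \o (f \o phi)) ->
  \int[leb2]_(x in D) f x = c * \int[leb2]_(x in phi @^-1` D) f (phi x).
Proof.
move=> [mphi c0 phiE] mD mf intf.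
have mpre : measurable (phi @^-1` D).
  by rewrite -[X in measurable X]setTI; exact: mphi.
pose k : {nonneg R} := NngNum (ltW c0).
pose m0 : measure plane R := pushforward leb2 phi.
pose m : measure plane R := mscale k (m0 mphi).
have mEFf : measurable_fun setT (EFin \o f) by exact/measurable_EFinP.
have im0 : (m0 mphi).-integrable D (EFin \o f) by exact: integrable_pushforward.
rewrite /Rintegral.
rewrite (@eq_measure_integral _ _ _ D m); last first.
  by move=> A mA _; rewrite -[LHS]phiE.
have -> : (\int[m]_(x in D) (f x)%:E =
    c%:E * \int[m0 mphi]_(x in D) (f x)%:E)%E.
  rewrite [LHS]integralE [in RHS]integralE.
  rewrite ge0_integral_mscale//; last exact/measurable_funepos/measurable_funTS.
  rewrite ge0_integral_mscale//; last exact/measurable_funeneg/measurable_funTS.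
  rewrite [RHS]muleBr//; apply: fin_num_adde_defl.
  by rewrite fin_numN integrable_neg_fin_num.
rewrite (integral_pushforward mphi mEFf intf mD) fineM.
- by [].
- by [].
- exact: (integrable_fin_num mpre intf).
Qed.

End change_of_variables.

(** * Measurability of closed sets in the plane *)

Section plane_measurability.
Variable R : realType.
Local Notation line := (measurableTypeR R).
Local Notation plane := (line * line)%type.

(** Rational squares form a countable base of the plane, so the product of the
    two Borel sigma-algebras contains every open set. *)
Lemma open_measurable_plane (A : set (R * R)) :
  open A -> measurable (A : set plane).
Proof.
move=> oA.
pose sq (i : rat * rat * rat) : set plane :=
  `](ratr i.1.1 - ratr i.2), (ratr i.1.1 + ratr i.2)[%classic `*`
  `](ratr i.1.2 - ratr i.2), (ratr i.1.2 + ratr i.2)[%classic.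
pose F i : set plane := if `[< sq i `<=` A >] then sq i else set0.
suff -> : A = \bigcup_i F i.
  apply: countable_bigcupT_measurable => // i; rewrite /F.
  by case: ifP => // _; apply: measurableX; exact: measurable_itv.
apply/seteqP; split => [[x y] Axy|[x y] [i _]]; last first.
  by rewrite /F; case: ifPn => // /asboolP; exact.
have /nbhs_ballP[e/= e0 eA] := open_nbhs_nbhs (conj oA Axy).
have [r /[!in_itv]/= /andP[r0 re]] : exists r, ratr r \in `]0, (e / 2)[.
  by apply: rat_in_itvoo; rewrite divr_gt0.
have [p /[!in_itv]/= /andP[p1 p2]] : exists p, ratr p \in `](x - ratr r), (x + ratr r)[.
  by apply: rat_in_itvoo; lra.
have [q /[!in_itv]/= /andP[q1 q2]] : exists p, ratr p \in `](y - ratr r), (y + ratr r)[.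
  by apply: rat_in_itvoo; lra.
exists ((p, q), r) => //.
rewrite /F ifT; first by rewrite /sq/= !in_itv/=; split; lra.
apply/asboolP => -[u v] [] /=; rewrite !in_itv/= => /andP[u1 u2] /andP[v1 v2].
apply: eA; split; rewrite /= /ball/= ltr_norml; lra.
Qed.

Lemma closed_measurable_plane (A : set (R * R)) :
  closed A -> measurable (A : set plane).
Proof.
by move=> /closed_openC/open_measurable_plane/measurableC; rewrite setCK.
Qed.

End plane_measurability.

(** * Integrals on the line *)

Section line_integrals.
Variable R : realType.
Local Notation mu := (@lebesgue_measure R).
Implicit Types (a b c r s x : R) (f g h : R -> R).

Lemma integrable_bounded_itv a b f (M : R) :
  measurable_fun `[a, b] f -> (forall x, x \in `[a, b] -> `|f x| <= M) ->
  mu.-integrable `[a, b] (EFin \o f).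
Proof.
move=> mf fM; apply: measurable_bounded_integrable => //.
  by rewrite /= lebesgue_measure_itv/=; case: ifPn; rewrite ltry.
exists M; split; first exact: num_real.
by move=> N MN x /= xab; rewrite (le_trans (fM x xab))// ltW.
Qed.

Lemma integrable_continuous_itv a b f :
  continuous f -> mu.-integrable `[a, b] (EFin \o f).
Proof.
move=> cf; apply: continuous_compact_integrable; first exact: segment_compact.
exact: continuous_subspaceT.
Qed.

Lemma continuous_cubic c0 c1 c2 c3 :
  continuous (fun x : R => c0 + c1 * x + c2 * x ^+ 2 + c3 * x ^+ 3).
Proof.
move=> x.
have dx : is_derive x 1 (fun x : R => c0 + c1 * x + c2 * x ^+ 2 + c3 * x ^+ 3)
    (c1 + c2 * 2 * x + c3 * 3 * x ^+ 2).
  by apply: is_derive_eq; rewrite /GRing.scale/=; ring.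
by apply/differentiable_continuous/derivable1_diffP; apply: ex_derive.
Qed.

Lemma Rintegral_cubic a b c0 c1 c2 c3 : a <= b ->
  \int[mu]_(x in `[a, b]) (c0 + c1 * x + c2 * x ^+ 2 + c3 * x ^+ 3) =
  (c0 * b + c1 / 2 * b ^+ 2 + c2 / 3 * b ^+ 3 + c3 / 4 * b ^+ 4) -
  (c0 * a + c1 / 2 * a ^+ 2 + c2 / 3 * a ^+ 3 + c3 / 4 * a ^+ 4).
Proof.
rewrite le_eqVlt => /predU1P[->|ab].
  by rewrite set_itv1 Rintegral_set1 subrr.
pose F (x : R) := c0 * x + c1 / 2 * x ^+ 2 + c2 / 3 * x ^+ 3 + c3 / 4 * x ^+ 4.
pose f (x : R) := c0 + c1 * x + c2 * x ^+ 2 + c3 * x ^+ 3.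
have dF x : is_derive x 1 F (f x).
  by apply: is_derive_eq; rewrite /f /GRing.scale/=; field.
rewrite /Rintegral [X in fine X](@continuous_FTC2 _ f F a b)//.
- exact/continuous_subspaceT/continuous_cubic.
- have cF : continuous F.
    by move=> x; apply/differentiable_continuous/derivable1_diffP; apply: ex_derive.
  split.
  + by move=> x _; apply: ex_derive.
  + by apply: cvg_at_right_filter; exact: cF.
  + by apply: cvg_at_left_filter; exact: cF.
- by move=> x _; rewrite derive1E; exact: derive_val.
Qed.

(** If [f] exceeds [g] only where the weight [w] is below the level [c], then,
    at equal total mass, [f] puts its mass on smaller values of [w]: the
    integral of [(w - c) * (f - g)] is nonpositive, and its constant part
    vanishes. *)
Lemma single_crossing a b c (w f g : R -> R) :

  mu.-integrable `[a, b] (EFin \o f) -> mu.-integrable `[a, b] (EFin \o g) ->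
  mu.-integrable `[a, b] (EFin \o (fun x => w x * f x)) ->
  mu.-integrable `[a, b] (EFin \o (fun x => w x * g x)) ->
  \int[mu]_(x in `[a, b]) f x = \int[mu]_(x in `[a, b]) g x ->
  (forall x, x \in `[a, b] -> (w x - c) * (f x - g x) <= 0) ->
  \int[mu]_(x in `[a, b]) (w x * f x) <= \int[mu]_(x in `[a, b]) (w x * g x).
Proof.
move=> if_ ig iwf iwg fg sgn.
have mab : measurable (`[a, b] : set (measurableTypeR R)) by exact: measurable_itv.
have icf : mu.-integrable `[a, b] (EFin \o (fun x => c * f x)).
  exact: (integrableZl mab c if_).
have icg : mu.-integrable `[a, b] (EFin \o (fun x => c * g x)).
  exact: (integrableZl mab c ig).
suff : \int[mu]_(x in `[a, b]) (w x * f x - c * f x) <=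
       \int[mu]_(x in `[a, b]) (w x * g x - c * g x).
  by rewrite !RintegralB// !RintegralZl// fg lerD2r.
apply: le_Rintegral => //.
- exact: (integrableB mab iwf icf).
- exact: (integrableB mab iwg icg).
- by move=> x /= /sgn; nra.
Qed.

Lemma integrable_cubicM a b f c0 c1 c2 c3 :
  mu.-integrable `[a, b] (EFin \o f) ->
  mu.-integrable `[a, b]
    (EFin \o (fun x => (c0 + c1 * x + c2 * x ^+ 2 + c3 * x ^+ 3) * f x)).
Proof.
move=> if_; pose p x := c0 + c1 * x + c2 * x ^+ 2 + c3 * x ^+ 3.
have cp : continuous p := @continuous_cubic c0 c1 c2 c3.
apply: (@integrableMr _ _ _ mu `[a, b] _ p (EFin \o f)) => //.
  by apply: measurable_funTS; apply: continuous_measurable_fun; exact: cp.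
have : compact (p @` `[a, b]).
  by apply: continuous_compact; [exact: continuous_subspaceT|exact: segment_compact].
move=> /compact_bounded[M [Mr HM]]; exists M; split => // N MN x /= xab.
by apply: (HM N MN); exists x.
Qed.

Lemma integrable_sqrM a b f :
  mu.-integrable `[a, b] (EFin \o f) ->
  mu.-integrable `[a, b] (EFin \o (fun x => x ^+ 2 * f x)).
Proof.
move=> /(@integrable_cubicM a b f 0 0 1 0); congr (integrable _ _ (_ \o _)).
by apply/funext => x; congr *%R; ring.
Qed.

Lemma Rintegral_pospart a b s h : a <= s -> s <= b ->
  mu.-integrable `[a, b] (EFin \o (fun x => h x * Num.max (s - x) 0)) ->
  \int[mu]_(x in `[a, b]) (h x * Num.max (s - x) 0) =
  \int[mu]_(x in `[a, s]) (h x * (s - x)).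
Proof.
move=> as_ sb ih.
have E : \int[mu]_(x in `]s, b]) (h x * Num.max (s - x) 0) = 0.
  rewrite (@eq_Rintegral _ _ _ mu _ (cst 0)).
    by rewrite Rintegral_cst ?mul0r//; exact: measurable_itv.
  move=> x; rewrite inE/= in_itv/= => /andP[sx _].
  by rewrite max_r ?mulr0// subr_le0 ltW.
have := Rintegral_itvB ih (as_ : (BLeft a <= BRight s)%O) (sb : (BRight s <= BRight b)%O).
rewrite E => /eqP; rewrite subr_eq0 => /eqP ->.
apply: eq_Rintegral => x; rewrite inE/= in_itv/= => /andP[_ xs].
by rewrite max_l// subr_ge0.
Qed.

Lemma integrable_pospart a b s :
  mu.-integrable `[a, b] (EFin \o (fun x => Num.max (s - x) 0)).
Proof.
apply: (@integrable_bounded_itv _ _ _ (`|s| + `|a| + `|b|)).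
  by apply: measurable_maxr => //; apply: measurable_funB.
move=> x; rewrite in_itv/= => /andP[ax xb].
have := ler_norm s; have := ler_norm (- s); have := ler_norm (- a).
have := normr_ge0 a; have := normr_ge0 b.
rewrite !normrN ler_norml; case: (leP (s - x) 0) => ?; lra.
Qed.

Lemma Rintegral_pospart0 a b s : a <= s -> s <= b ->
  \int[mu]_(x in `[a, b]) Num.max (s - x) 0 = (s - a) ^+ 2 / 2.
Proof.
move=> as_ sb; rewrite (@eq_Rintegral _ _ _ mu _ (fun x => 1 * Num.max (s - x) 0)).
  rewrite Rintegral_pospart//; last first.
    by apply: (integrableZl _ 1 (integrable_pospart _ _ _)); exact: measurable_itv.
  rewrite (@eq_Rintegral _ _ _ mu _ (fun x => s + (-1) * x + 0 * x ^+ 2 + 0 * x ^+ 3)).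
    by rewrite Rintegral_cubic//; field.
  by move=> x _; ring.
by move=> x _; rewrite mul1r.
Qed.

Lemma Rintegral_pospart2 a b s : a <= s -> s <= b ->
  \int[mu]_(x in `[a, b]) (x ^+ 2 * Num.max (s - x) 0) =
  s * (s ^+ 3 - a ^+ 3) / 3 - (s ^+ 4 - a ^+ 4) / 4.
Proof.
move=> as_ sb; rewrite Rintegral_pospart//; last first.
  exact/integrable_sqrM/integrable_pospart.
rewrite (@eq_Rintegral _ _ _ mu _ (fun x => 0 + 0 * x + s * x ^+ 2 + (-1) * x ^+ 3)).
  by rewrite Rintegral_cubic//; field.
by move=> x _; ring.
Qed.

End line_integrals.

(** * Extremal profiles *)

Section profiles.
Variable R : realType.
Local Notation mu := (@lebesgue_measure R).

(** Provides the abscissa at which a profile, possibly discontinuous, crosses the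
    extremal one. *)
Lemma cut_point (a b : R) (P : R -> Prop) : a <= b ->
  (forall x y, a <= x -> x <= y -> y <= b -> P y -> P x) ->
  exists2 r, a <= r <= b &
    (forall x, a <= x <= b -> x < r -> P x) /\
    (forall x, a <= x <= b -> r < x -> ~ P x).
Proof.
move=> ab Pdown; pose S := [set x | a <= x <= b /\ (x = a \/ P x)].
have Sa : S a by split; [rewrite lexx ab|left].
have Sub : ubound S b by move=> x [/andP[]].
have supS : has_sup S by split; [exists a|exists b].
exists (sup S).
  by apply/andP; split; [apply: ub_le_sup => //; exists b|apply: ge_sup => //; exists a].
split=> x /andP[ax xb].
- move=> /(sup_gt (ex_intro _ a Sa))[y [/andP[ay yb] [->|Py]] xy].
    by move: xy; rewrite ltNge ax.
  exact: (Pdown _ y ax (ltW xy) yb Py).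
- move=> rx Px; move: rx; rewrite ltNge => /negP; apply.
  by apply: ub_le_sup; [exists b|split; [rewrite ax xb|right]].
Qed.

(** The extremal profile is [min (4 - 2 * x) (4 - 2 * d)].  Since [X] is
    nonincreasing and at most [4 - 2 * x], it can only cross the constant part
    of this profile, and only once. *)
Lemma inner_profile (X : R -> R) (A : R) :
  measurable_fun `[0%R : R, 1] X ->
  (forall x, 0 <= x <= 1 -> 2 <= X x <= 4 - 2 * x) ->
  (forall x y, 0 <= x -> x <= y -> y <= 1 -> X y <= X x) ->
  \int[mu]_(x in `[0%R : R, 1]) X x = 2 + A ->
  [/\ 0 <= A, A <= 1 &
  \int[mu]_(x in `[0%R : R, 1]) (x ^+ 2 * X x) <= 2 / 3 + (2 * A - A ^+ 2) / 6].
Proof.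
move=> mX bX dX IX.
have iX : mu.-integrable `[0%R : R, 1] (EFin \o X).
  apply: (@integrable_bounded_itv _ _ _ _ 4) => // x.
  rewrite in_itv/= => x01; have := bX x x01; move: x01.
  by rewrite ler_norml; lra.
have cub c0 c1 c2 c3 := @Rintegral_cubic R 0 1 c0 c1 c2 c3 ler01.
have icub a c0 c1 c2 c3 : mu.-integrable `[0, a]
    (EFin \o (fun x => c0 + c1 * x + c2 * x ^+ 2 + c3 * x ^+ 3)).
  exact/integrable_continuous_itv/continuous_cubic.
have m01 : measurable (`[0%R, 1] : set (measurableTypeR R)) by exact: measurable_itv.
have A0 : 0 <= A.
  have := @le_Rintegral _ _ _ mu `[0%R : R, 1] _ X m01 (icub 1 2 0 0 0) iX.
  rewrite cub IX => H; suff : 2 <= 2 + A by lra.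
  apply: le_trans (H _); first by lra.
  by move=> x /=; rewrite in_itv/= => /bX; lra.
have A1 : A <= 1.
  have := @le_Rintegral _ _ _ mu `[0%R : R, 1] X _ m01 iX (icub 1 4 (-2) 0 0).
  rewrite cub IX => H; suff : 2 + A <= 3 by lra.
  apply: le_trans (H _) _; last by lra.
  by move=> x /=; rewrite in_itv/= => /bX; lra.
split => //.
(* This value of [d] gives the extremal profile the same integral as [X]. *)
pose d := Num.sqrt (1 - A).
have d0 : 0 <= d by exact: sqrtr_ge0.
have d2 : d ^+ 2 = 1 - A by rewrite sqr_sqrtr// subr_ge0.
have d1 : d <= 1 by nra.
(* That is, [g x = min (4 - 2 * x) (4 - 2 * d)]. *)
pose g x := (4 - 2 * x) - 2 * Num.max (d - x) 0.
have iline : mu.-integrable `[0%R : R, 1] (EFin \o (fun x : R => 4 - 2 * x)).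
  by apply/integrable_continuous_itv => x; apply: cvgB; [exact: cvg_cst|exact: cvgMr].
have ipos : mu.-integrable `[0%R : R, 1] (EFin \o (fun x : R => 2 * Num.max (d - x) 0)).
  exact: (integrableZl m01 2 (integrable_pospart _ _ _)).
have ig : mu.-integrable `[0%R : R, 1] (EFin \o g) by exact: (integrableB m01 iline ipos).
have Ig : \int[mu]_(x in `[0%R : R, 1]) g x = 2 + A.
  rewrite RintegralB// RintegralZl//; last exact: integrable_pospart.
  rewrite Rintegral_pospart0// subr0 d2.
  rewrite (@eq_Rintegral _ _ _ mu _ (fun x => 4 + (-2) * x + 0 * x ^+ 2 + 0 * x ^+ 3)).
    by rewrite cub; field.
  by move=> x _; ring.
have Ig2 : \int[mu]_(x in `[0%R : R, 1]) (x ^+ 2 * g x) = 2 / 3 + (2 * A - A ^+ 2) / 6.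
  rewrite (@eq_Rintegral _ _ _ mu _ (fun x => x ^+ 2 * (4 - 2 * x) -
      2 * (x ^+ 2 * Num.max (d - x) 0))); last by move=> x _; rewrite /g; ring.
  have i2 := @integrable_sqrM _ 0 1 _ (integrable_pospart 0 1 d).
  rewrite RintegralB//; [|exact: integrable_sqrM|exact: (integrableZl m01 2 i2)].
  rewrite RintegralZl// Rintegral_pospart2//.
  rewrite (@eq_Rintegral _ _ _ mu _ (fun x => 0 + 0 * x + 4 * x ^+ 2 + (-2) * x ^+ 3)).
    rewrite cub (_ : d ^+ 4 = (d ^+ 2) ^+ 2); last by ring.
    rewrite (_ : d * (d ^+ 3 - 0 ^+ 3) = (d ^+ 2) ^+ 2); last by ring.
    by rewrite d2; field.
  by move=> x _; ring.
rewrite -Ig2.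
have [r /andP[r0 r1] [Pr Nr]] : exists2 r, 0 <= r <= 1 &
    (forall x, 0 <= x <= 1 -> x < r -> 4 - 2 * d <= X x) /\
    (forall x, 0 <= x <= 1 -> r < x -> ~ 4 - 2 * d <= X x).
  apply: cut_point => // x y x0 xy y1 /le_trans; apply; exact: dX.
apply: (@single_crossing _ 0 1 (r ^+ 2)) => //.
- exact: integrable_sqrM.
- exact: integrable_sqrM.
- by rewrite IX Ig.
move=> x; rewrite in_itv/= => x01; have /andP[X2 X4] := bX x x01.
have gd : g x <= 4 - 2 * d by rewrite /g; case: (leP (d - x) 0) => ?; lra.
have [xr|rx|->] := ltgtP x r; last by rewrite subrr mul0r.
- have Xd := Pr x x01 xr; move/andP: x01 => [x0 _].
  by apply: mulr_le0_ge0; [nra|lra].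
- have /negP := Nr x x01 rx; rewrite -ltNge => Xd.
  have : X x <= g x by rewrite /g; case: (leP (d - x) 0) => ?; lra.
  by move=> ?; apply: mulr_ge0_le0; [nra|lra].
Qed.

(** The extremal profile is the linear one, falling from [2] at [1] to [0] at
    [1 + B].  Concavity along chords issued from the point [(1, 2)] makes the
    set where [X] is above this line an interval starting at [1].  It is asked
    only at the points [v] with [0 < X v], because the slices of a body may
    jump to [0] at the end of its support. *)
Lemma outer_profile (X : R -> R) (B : R) :
  measurable_fun `[1%R : R, 2] X ->
  (forall x, 1 <= x <= 2 -> 0 <= X x <= 4 - 2 * x) ->
  (forall u v, 1 <= u -> u <= v -> v <= 2 -> 0 < X v ->
    2 * (v - u) + (u - 1) * X v <= (v - 1) * X u) ->
  \int[mu]_(x in `[1%R : R, 2]) X x = B ->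
  [/\ 0 <= B, B <= 1 &
  \int[mu]_(x in `[1%R : R, 2]) (x ^+ 2 * X x) <=
    B + 2 / 3 * B ^+ 2 + B ^+ 3 / 6].
Proof.
move=> mX bX cX IX.
have iX : mu.-integrable `[1%R : R, 2] (EFin \o X).
  apply: (@integrable_bounded_itv _ _ _ _ 4) => // x.
  rewrite in_itv/= => x01; have := bX x x01; move: x01.
  by rewrite ler_norml; lra.
have le12 : 1 <= 2 :> R by lra.
have m12 : measurable (`[1%R, 2] : set (measurableTypeR R)) by exact: measurable_itv.
have B0 : 0 <= B.
  by rewrite -IX; apply: Rintegral_ge0 => x; rewrite /= in_itv/= => /bX; lra.
have B1 : B <= 1.
  have := @le_Rintegral _ _ _ mu `[1%R : R, 2] X _ m12 iX
    (integrable_continuous_itv _ _ (@continuous_cubic _ 4 (-2) 0 0)).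
  rewrite Rintegral_cubic// IX => H; apply: le_trans (H _) _; last by lra.
  by move=> x /=; rewrite in_itv/= => /bX; lra.
split => //.
move: B0; rewrite le_eqVlt => /predU1P[B0|B0].
  rewrite -B0 !(expr0n, mulr0, mul0r, addr0)/=.
  apply: (@le_trans _ _ (\int[mu]_(x in `[1%R : R, 2]) (4 * X x))).
    apply: le_Rintegral => //; [exact: integrable_sqrM|exact: (integrableZl m12 4 iX)|].
    move=> x; rewrite /= in_itv/= => x12; have /andP[X0 _] := bX x x12.
    by apply: ler_wpM2r => //; move: x12; nra.
  by rewrite RintegralZl// IX -B0 mulr0.
pose s := 1 + B.
have s1 : 1 <= s by rewrite /s; lra.
have s2 : s <= 2 by rewrite /s; lra.
pose g x := (2 / B) * Num.max (s - x) 0.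
have ig : mu.-integrable `[1%R : R, 2] (EFin \o g).
  exact: (integrableZl m12 _ (integrable_pospart _ _ _)).
have Ig : \int[mu]_(x in `[1%R : R, 2]) g x = B.
  rewrite RintegralZl//; last exact: integrable_pospart.
  by rewrite Rintegral_pospart0// /s; field; rewrite gt_eqF.
have Ig2 : \int[mu]_(x in `[1%R : R, 2]) (x ^+ 2 * g x) = B + 2 / 3 * B ^+ 2 + B ^+ 3 / 6.
  rewrite (@eq_Rintegral _ _ _ mu _ (fun x => (2 / B) *
      (x ^+ 2 * Num.max (s - x) 0))); last by move=> x _; rewrite /g; ring.
  rewrite RintegralZl//; last exact/integrable_sqrM/integrable_pospart.
  by rewrite Rintegral_pospart2// /s; field; rewrite gt_eqF.
rewrite -Ig2.
have [r /andP[r1 r2] [Pr Nr]] : exists2 r, 1 <= r <= 2 &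
    (forall x, 1 <= x <= 2 -> x < r -> 0 < X x /\ 2 * (s - x) <= B * X x) /\
    (forall x, 1 <= x <= 2 -> r < x -> ~ (0 < X x /\ 2 * (s - x) <= B * X x)).
  apply: cut_point => // x y x1 xy y2 [Xy0 Xy].
  have [->//|xy'] := eqVneq x y.
  have {}xy' : x < y by rewrite lt_neqAle xy' xy.
  have Xx := cX x y x1 xy y2 Xy0.
  have y1 : 0 < y - 1 by lra.
  have ? : 0 <= (x - 1) * X y by apply: mulr_ge0; lra.
  split; first by rewrite -(pmulr_rgt0 _ y1); lra.
  rewrite -(ler_pM2l y1); have := ler_wpM2l (ltW B0) Xx.
  have : 0 <= (x - 1) * (B * X y - 2 * (s - y)) by apply: mulr_ge0; lra.
  by rewrite /s; lra.
apply: (@single_crossing _ 1 2 (r ^+ 2)) => //.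
- exact: integrable_sqrM.
- exact: integrable_sqrM.
- by rewrite IX Ig.
move=> x; rewrite in_itv/= => x12; have /andP[X0 X4] := bX x x12.
have gB : B * g x = 2 * Num.max (s - x) 0 by rewrite /g; field; rewrite gt_eqF.
have [xr|rx|->] := ltgtP x r; last by rewrite subrr mul0r.
- have [_ H] := Pr x x12 xr.
  have : g x <= X x.
    rewrite -(ler_pM2l B0) gB; case: (leP (s - x) 0) => ? //.
    by rewrite mulr0 mulr_ge0// ltW.
  by move/andP: x12 => [x1 _] ?; apply: mulr_le0_ge0; [nra|lra].
- have H : X x <= g x.
    rewrite -(ler_pM2l B0) gB; have := Nr x x12 rx.
    have [Xx0|Xx0] := ltP 0 (X x); last first.
      by move=> _; rewrite (_ : X x = 0) ?mulr0 ?mulr_ge0 ?le_max ?lexx ?orbT//; lra.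
    move=> H; have : B * X x < 2 * (s - x) by rewrite ltNge; apply/negP => H'; apply: H.
    by case: (leP (s - x) 0) => ?; lra.
  by move/andP: x12 => [x1 _]; apply: mulr_ge0_le0; [nra|lra].
Qed.

End profiles.

(** * The inequality between cap areas *)

(** The difference of the two sides is a sum of nonnegative terms, each of which
    vanishes at [A = B = 0] and at [A = B = 1]. *)
Lemma cap_area_inequality (R : realFieldType) (A B : R) :
  0 <= A -> A <= 1 -> 0 <= B -> B <= 1 ->
  (4 + 6 * A + 4 * A ^+ 2 + A ^+ 3 + 2 * B - B ^+ 2) *
  (4 + 6 * B + 4 * B ^+ 2 + B ^+ 3 + 2 * A - A ^+ 2) <= (2 + A + B) ^+ 4.
Proof.
move=> A0 A1 B0 B1.
have q0 : 0 <= A * B by exact: mulr_ge0.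
have q1 : A * B <= 1 by exact: mulr_ile1.
rewrite -subr_ge0.
rewrite (_ : _ - _ = 2 * ((A + B) * (A - B) ^+ 2)
  + 2 * ((A - B) ^+ 2 * (A ^+ 2 + A * B + B ^+ 2)) + (A ^+ 2 - B ^+ 2) ^+ 2
  + 4 * (A * B * (A + B) * (1 - A * B)) + A * B * (1 - A * B) * (8 - A * B)
  + (A ^+ 5 * (1 - A) + B ^+ 5 * (1 - B) + (A ^+ 3 - B ^+ 3) ^+ 2)); last by ring.
have p : 0 <= A + B by exact: addr_ge0.
have u : 0 <= 1 - A * B by rewrite subr_ge0.
have v : 0 <= 8 - A * B by lra.
have w : 0 <= A ^+ 2 + A * B + B ^+ 2 by rewrite !addr_ge0// sqr_ge0.
have : 0 <= 1 - A by rewrite subr_ge0.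
have : 0 <= 1 - B by rewrite subr_ge0.
move=> ? ?; do ?apply: addr_ge0;
  by do ?[exact: sqr_ge0|exact: exprn_ge0|done|apply: mulr_ge0].
Qed.

(** * Slices of plane sets *)

Section slices.
Variable R : realType.
Local Notation line := (measurableTypeR R).
Local Notation plane := (line * line)%type.
Local Notation leb := (@lebesgue_measure R).
Local Notation leb2 := (@lebesgue_measure2 R).

Definition slice (K : set (R * R)) (u : R) : R := fine (leb (xsection K u)).

Lemma measurable_slice (K : set plane) : measurable K ->
  measurable_fun setT (slice K).
Proof.
move=> mK; apply: (@measurableT_comp _ _ _ _ _ _ fine) => //.
exact: measurable_fun_xsection.
Qed.

(** A square that contains the diamond [|u| + |v| <= 2], used for finiteness of
    the integrals. *)
Definition box : set (R * R) := `[-2, 2]%classic `*` `[-2, 2]%classic.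

Lemma measurable_box : measurable (box : set plane).
Proof. by apply: measurableX; exact: measurable_itv. Qed.

Lemma leb2_box_lty (K : set plane) : measurable K -> K `<=` box ->
  (leb2 K < +oo)%E.
Proof.
move=> mK Kb; apply: (@le_lt_trans _ _ (leb2 (box : set plane))).
  by apply: le_measure => //; rewrite inE//; exact: measurable_box.
rewrite [leb2 _]product_measure1E//= !lebesgue_measure_itv/= !lte_fin.
by case: ifPn => _; rewrite ltry.
Qed.

Lemma leb_xsection_lty (K : set plane) u : K `<=` box -> measurable K ->
  (leb (xsection K u) < +oo)%E.
Proof.
move=> Kb mK; apply: (@le_lt_trans _ _ (leb `[-2, 2])).
  apply: le_measure; [|by rewrite inE; exact: measurable_itv|].
    by rewrite inE; exact: measurable_xsection.
  by move=> y /xsectionP/Kb [].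
by rewrite lebesgue_measure_itv/=; case: ifPn => _; rewrite ltry.
Qed.

Lemma integrable_box (K : set plane) (f : plane -> R) (M : R) :
  measurable K -> K `<=` box -> measurable_fun setT f ->
  (forall z, box z -> `|f z| <= M) -> leb2.-integrable K (EFin \o f).
Proof.
move=> mK Kb mf fM; apply: measurable_bounded_integrable => //.
- exact: leb2_box_lty.
- exact: measurable_funTS.
- exists M; split; first exact: num_real.
  by move=> N MN z /= /Kb/fM zM; rewrite (le_trans zM)// ltW.
Qed.

Lemma Rintegral_slice (K : set plane) (I : set line) (f : R -> R) :
  measurable K -> K `<=` box -> measurable I -> measurable_fun setT f ->
  (forall x, 0 <= f x) ->
  \int[leb2]_(z in K `&` (fst @^-1` I)) f z.1 =
  \int[leb]_(x in I) (f x * slice K x).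
Proof.
move=> mK Kb mI mf f0; rewrite /Rintegral; congr fine.
have mD : measurable (K `&` fst @^-1` I : set plane).
  apply: measurableI => //; rewrite -[X in measurable X]setTI.
  exact: (@measurable_fst _ _ line line).
rewrite integral_mkcond [LHS](fubini_tonelli1 (m1 := leb) (m2 := leb)); last first.
  by move=> z; rewrite patchE; case: ifPn => // _; rewrite lee_fin.
  apply/(measurable_restrictT _ mD); apply/measurable_EFinP.
  by apply: measurable_funTS; apply: measurableT_comp.
rewrite [RHS]integral_mkcond; apply: eq_integral => x _.
rewrite patchE; case: ifPn => xI; last first.
  rewrite /fubini_F integral0_eq// => y _; rewrite patchE ifF//.
  by apply/negbTE; apply: contra xI; rewrite !inE => -[].
rewrite /fubini_F EFinM fineK; last first.
  rewrite ge0_fin_numE//; exact: leb_xsection_lty.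
transitivity (\int[leb]_(y in xsection K x) (cst (f x)%:E y))%E.
  rewrite [RHS]integral_mkcond; apply: eq_integral => y _.
  rewrite !patchE; congr (if _ then _ else _).
  apply/idP/idP; rewrite !inE; first by case=> Kxy _; apply/xsectionP.
  by move/xsectionP => Kxy; split => //; move: xI; rewrite inE.
by rewrite integral_cst//; exact: measurable_xsection.
Qed.

End slices.

(** * Bodies between a square and a diamond *)

Section inscribed_square.
Variable R : realType.
Local Notation line := (measurableTypeR R).
Local Notation plane := (line * line)%type.
Local Notation leb := (@lebesgue_measure R).
Local Notation leb2 := (@lebesgue_measure2 R).
Implicit Types (K : set (R * R)) (u v a b t : R).

Record between_square_and_diamond K : Prop := BetweenSquareAndDiamond {
  bsd_closed : closed K;
  bsd_convex : forall t u v u' v', 0 <= t <= 1 -> K (u, v) -> K (u', v') ->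
    K (t * u + (1 - t) * u', t * v + (1 - t) * v');
  bsd_symmetric : forall u v, K (u, v) -> K (- u, - v);
  bsd_square : forall u v, `|u| <= 1 -> `|v| <= 1 -> K (u, v);
  bsd_diamond : forall u v, K (u, v) -> `|u| + `|v| <= 2 }.

Variable K : set (R * R).
Hypothesis HK : between_square_and_diamond K.

Lemma bsd_measurable : measurable (K : set plane).
Proof. by apply: closed_measurable_plane; exact: bsd_closed HK. Qed.

Lemma bsd_box : K `<=` @box R.
Proof.
move=> [u v] /(bsd_diamond HK) uv; have := normr_ge0 u; have := normr_ge0 v.
by move=> v0 u0; split => /=; rewrite in_itv/= -ler_norml; lra.
Qed.

(** Slices are compact and convex; the end points are kept because concavity of
    the length comes from combining the end points of two slices. *)
Lemma slice_itv u v : K (u, v) ->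
  exists a b, [/\ K (u, a), K (u, b), a <= b,
    forall v, K (u, v) -> a <= v <= b & slice K u = b - a].
Proof.
move=> Kuv; pose C : set R := (fun v => (u, v)) @^-1` K.
have cC : compact C.
  apply: (subclosed_compact _ (@segment_compact _ (-2) 2)).
    apply: preimage_closed; last exact: (bsd_closed HK).
    by move=> x _; refine (@cvg_pair _ _ _ _ _ _ _ _ _ (cst u) id (cvg_cst _) (@cvg_id _ _)).
  by move=> y /bsd_box [].
have C0 : C !=set0 by exists v.
have [b /[!inE] Cb bmax] := @compact_EVT_max _ R id C C0 cC (@continuous_subspaceT _ _ _ _ (fun x => @cvg_id _ _)).
have [a /[!inE] Ca amin] := @compact_EVT_max _ R -%R C C0 cC (@continuous_subspaceT _ _ _ _ (@opp_continuous _)).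
have range y : K (u, y) -> a <= y <= b.
  by move=> Ky; rewrite -lerN2 amin ?inE// bmax ?inE.
have ab : a <= b by have /andP[/le_trans] := range v Kuv; apply.
exists a, b; split => //.
rewrite /slice (_ : xsection K u = `[a, b]%classic).
  rewrite lebesgue_measure_itv/= lte_fin; move: ab.
  by rewrite le_eqVlt => /predU1P[->|->//]; rewrite ltxx subrr.
apply/seteqP; split=> [y /xsectionP/range|y]; rewrite /= in_itv//=.
move=> /andP[ay yb]; apply/xsectionP.
have [abE|abN] := eqVneq a b.
  by rewrite (_ : y = a)//; apply/le_anti; rewrite ay abE yb.
have ab0 : 0 < b - a by rewrite subr_gt0 lt_neqAle abN ab.
have t01 : 0 <= (y - a) / (b - a) <= 1.
  by rewrite divr_ge0 ?subr_ge0//= ler_pdivrMr// mul1r lerB.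
have := bsd_convex HK t01 Cb Ca; congr (K (_, _)); first by ring.
by field; rewrite gt_eqF.
Qed.

Lemma slice_notin u : (forall v, ~ K (u, v)) -> slice K u = 0.
Proof.
move=> Ku; rewrite /slice (_ : xsection K u = set0) ?measure0//.
by rewrite -subset0 => v /xsectionP /Ku.
Qed.

Lemma slice_ge u a b : K (u, a) -> K (u, b) -> b - a <= slice K u.
Proof.
move=> Ka Kb; have [a' [b' [_ _ _ ab ->]]] := slice_itv Ka.
by have := ab _ Ka; have := ab _ Kb; lra.
Qed.

Lemma slice_ge0 u : 0 <= slice K u.
Proof. by rewrite /slice fine_ge0. Qed.

Lemma slice_gt0 u : 0 < slice K u -> exists v, K (u, v).
Proof.
move=> Ku; apply: contrapT => /forallNP/slice_notin E.
by rewrite E ltxx in Ku.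
Qed.

Lemma slice_concave t u v u' v' : 0 <= t <= 1 -> K (u, v) -> K (u', v') ->
  t * slice K u + (1 - t) * slice K u' <= slice K (t * u + (1 - t) * u').
Proof.
move=> t01 /slice_itv[a [b [Ka Kb _ _ ->]]] /slice_itv[c [d [Kc Kd _ _ ->]]].
have := slice_ge (bsd_convex HK t01 Ka Kc) (bsd_convex HK t01 Kb Kd).
by apply: le_trans; rewrite le_eqVlt; apply/orP; left; apply/eqP; ring.
Qed.

Lemma sliceN u : slice K (- u) = slice K u.
Proof.
have le w : slice K w <= slice K (- w).
  have := slice_ge0 w; rewrite le_eqVlt => /predU1P[<-|/slice_gt0[v]].
    exact: slice_ge0.
  move=> /slice_itv[a [b [Ka Kb _ _ ->]]].
  have := slice_ge (bsd_symmetric HK Kb) (bsd_symmetric HK Ka).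
  by rewrite opprK addrC.
by apply/le_anti; rewrite le andbT -{2}(opprK u) le.
Qed.

Lemma slice_ge2 u : `|u| <= 1 -> 2 <= slice K u.
Proof.
move=> u1; have := @slice_ge u (-1) 1.
rewrite opprK; apply; apply: (bsd_square HK) => //; rewrite ?normrN normr1//.
Qed.

Lemma slice_le u : 0 <= u <= 2 -> slice K u <= 4 - 2 * u.
Proof.
move=> /andP[u0 u2].
have := slice_ge0 u; rewrite le_eqVlt => /predU1P[<-|/slice_gt0[v]]; first by lra.
move=> /slice_itv[a [b [Ka Kb _ _ ->]]].
have := bsd_diamond HK Ka; have := bsd_diamond HK Kb; rewrite (ger0_norm u0).
by have := ler_norm b; have := ler_norm (- a); rewrite normrN; lra.
Qed.

(** The slice at [u] is a convex combination of the slices at [v] and [- v],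
    which have the same length. *)
Lemma slice_noninc u v : 0 <= u -> u <= v -> v <= 1 -> slice K v <= slice K u.
Proof.
move=> u0 uv v1.
have Kv : K (v, 0) by apply: (bsd_square HK); rewrite ?normr0// ger0_norm//; lra.
have KNv : K (- v, 0) by rewrite -[0]oppr0; exact: (bsd_symmetric HK).
have [v0|v0] := eqVneq v 0; first by rewrite (_ : u = v)//; lra.
have vp : 0 < v by rewrite lt_neqAle eq_sym v0; lra.
have t01 : 0 <= (1 + u / v) / 2 <= 1.
  have : 0 <= u / v by rewrite divr_ge0// ltW.
  have : u / v <= 1 by rewrite ler_pdivrMr// mul1r.
  by lra.
have := slice_concave t01 Kv KNv; rewrite sliceN.
rewrite (_ : _ * v + _ = u); last by field.
by apply: le_trans; rewrite -mulrDl addrCA subrr addr0 mul1r.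
Qed.

(** Concavity along the chord from [1] to [v]; the slice at [1] contains a side
    of the square. *)
Lemma slice_outer u v : 1 <= u -> u <= v -> v <= 2 -> 0 < slice K v ->
  2 * (v - u) + (u - 1) * slice K v <= (v - 1) * slice K u.
Proof.
move=> u1 uv v2 /slice_gt0[w Kvw].
have [v1|v1] := eqVneq v 1; first by rewrite (_ : u = v); lra.
have vp : 0 < v - 1 by rewrite subr_gt0 lt_neqAle eq_sym v1; lra.
have t01 : 0 <= (u - 1) / (v - 1) <= 1.
  by rewrite divr_ge0 ?subr_ge0//=; [rewrite ler_pdivrMr// mul1r; lra|lra].
have K1 : K (1, 0) by apply: (bsd_square HK); rewrite ?normr0// normr1.
have := slice_concave t01 Kvw K1.
rewrite (_ : _ * v + _ = u); last by field; rewrite gt_eqF.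
rewrite -(ler_pM2l vp); apply: le_trans.
have s1 : 2 <= slice K 1 by apply: slice_ge2; rewrite normr1.
rewrite (_ : (v - 1) * _ = (u - 1) * slice K v + (v - u) * slice K 1); last first.
  by field; rewrite gt_eqF.
by rewrite addrC lerD2l mulrC ler_wpM2l//; lra.
Qed.

End inscribed_square.

(** * Integrals of even functions of one coordinate *)

Section even_integrals.
Variable R : realType.
Local Notation line := (measurableTypeR R).
Local Notation plane := (line * line)%type.
Local Notation leb := (@lebesgue_measure R).
Local Notation leb2 := (@lebesgue_measure2 R).
Variable K : set (R * R).
Hypothesis HK : between_square_and_diamond K.

Let mK : measurable (K : set plane) := bsd_measurable HK.

Lemma slice_le4 u : `|slice K u| <= 4.
Proof.
rewrite ger0_norm ?slice_ge0//.
have [u2|u2] := leP `|u| 2; last first.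
  rewrite slice_notin// => v /(bsd_diamond HK).
  by have := normr_ge0 v; lra.
have <- : slice K `|u| = slice K u by case: (ger0P u) => // _; exact: sliceN.
have := @slice_le _ _ HK `|u|; rewrite normr_ge0 u2 => /(_ isT).
by have := normr_ge0 u; lra.
Qed.

Lemma integrable_sliceM (a b : R) (f : R -> R) (M : R) :
  measurable_fun setT f -> (forall x, x \in `[a, b] -> `|f x| <= M) ->
  leb.-integrable `[a, b] (EFin \o (fun x => f x * slice K x)).
Proof.
move=> mf fM; apply: (@integrable_bounded_itv _ _ _ _ (M * 4)) => [|x xab].
  by apply: measurable_funTS; apply: measurable_funM => //; exact: measurable_slice.
by rewrite normrM ler_pM// ?fM// slice_le4.
Qed.

Lemma Rintegral_itv_split (a b c : R) (h : R -> R) : a <= b -> b <= c ->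
  leb.-integrable `[a, c] (EFin \o h) ->
  \int[leb]_(x in `[a, c]) h x =
  \int[leb]_(x in `[a, b]) h x + \int[leb]_(x in `[b, c]) h x.
Proof.
move=> ab bc ih; rewrite -(@Rintegral_itv_obnd_cbnd _ b); last first.
  apply: integrableS ih; [exact: measurable_itv|exact: measurable_itv|].
  by apply: subset_itv; rewrite bnd_simp.
rewrite -(@Rintegral_itvB _ h (BLeft a) (BRight c) b ih) ?bnd_simp//.
by rewrite addrC subrK.
Qed.

(** The reflection through the origin exchanges the two halves of the body. *)
Lemma Rintegral_even (f : R -> R) (M : R) :
  measurable_fun setT f -> (forall x, 0 <= f x) -> (forall x, f (- x) = f x) ->
  (forall x, `|x| <= 2 -> f x <= M) ->
  \int[leb2]_(z in K) f z.1 = 2 * \int[leb]_(x in `[0, 2]) (f x * slice K x).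
Proof.
move=> mf f0 fN fM.
have mff : measurable_fun setT (fun z : plane => f z.1) by exact: measurableT_comp.
have iK (L : set plane) : measurable L -> L `<=` K ->
    leb2.-integrable L (EFin \o (fun z => f z.1)).
  move=> mL LK; apply: (@integrable_box _ _ _ M) => //.
    by move=> z /LK; exact: bsd_box.
  move=> [u v] [/= + _]; rewrite in_itv/= -ler_norml => u2.
  by rewrite ger0_norm// fM.
have mfst (I : set line) : measurable I -> measurable (K `&` fst @^-1` I : set plane).
  move=> mI; apply: measurableI => //; rewrite -[X in measurable X]setTI.
  exact: (@measurable_fst _ _ line line).
have mn : measurable (`[(-2), 0[%classic : set line) by exact: measurable_itv.
have mp : measurable (`]0, 2]%classic : set line) by exact: measurable_itv.
have mc : measurable (`[0, 2]%classic : set line) by exact: measurable_itv.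
have KE : K = (K `&` fst @^-1` `[(-2), 0[%classic) `|` (K `&` fst @^-1` `[0, 2]%classic).
  rewrite -setIUr; apply/esym/setIidl => -[u v] /(bsd_box HK)[/= + _].
  rewrite !in_itv/= => /andP[u1 u2]; case: (leP 0 u) => u0; [right|left].
    by rewrite u2.
  by rewrite u1.
rewrite {1}KE Rintegral_setU//; [|exact: mfst|exact: mfst|by rewrite -KE;
  exact: iK|]; last first.
  apply/disj_setPS => -[u v] [[_ /=]] + [_ /=];
    rewrite !in_itv/= => /andP[_ u0] /andP[u0' _].
  by move: u0; rewrite ltNge u0'.
have N0 : (-1) * (-1) - 0 * 0 != 0 :> R by rewrite mulr0 subr0 mulrNN mulr1 oner_neq0.
have := linear_scales_area N0; set phi := (X in scales_area X _).
rewrite mulrNN mulr1 mulr0 subr0 normr1 => sphi.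
have phiE : phi @^-1` (K `&` fst @^-1` `[(-2), 0[%classic) = K `&` fst @^-1` `]0, 2]%classic.
  apply/seteqP; split => -[u v]; rewrite /phi /= !in_itv/= !(mulN1r, mul0r, addr0, add0r).
    by move=> [/(bsd_symmetric HK)]; rewrite !opprK => Kuv /andP[? ?]; split => //; lra.
  by move=> [/(bsd_symmetric HK) Kuv /andP[? ?]]; split => //; lra.
have fphi : (fun z => f (phi z).1) = fun z => f z.1.
  by apply/funext => -[u v]; rewrite /phi/= mulN1r mul0r addr0 fN.
rewrite (integral_scales_area sphi)//; last 2 first.
- exact: mfst.
- by rewrite phiE [_ \o phi]fphi; apply: iK; [exact: mfst|exact: subIsetl].
rewrite phiE [X in Rintegral _ _ X]fphi mul1r.
rewrite !Rintegral_slice//; [|exact: bsd_box|exact: bsd_box].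
rewrite Rintegral_itv_obnd_cbnd; last first.
  apply: (integrableS mc mp); first by apply: subset_itv; rewrite bnd_simp.
  apply: (@integrable_sliceM _ _ _ M) => // x; rewrite in_itv/= => /andP[x0 x2].
  by rewrite ger0_norm// fM// ger0_norm.
by rewrite -mulr2n mulr_natl.
Qed.

End even_integrals.

(** * Second moments and cap areas *)

Section moments_of_inscribed.
Variable R : realType.
Local Notation line := (measurableTypeR R).
Local Notation plane := (line * line)%type.
Local Notation leb := (@lebesgue_measure R).
Local Notation leb2 := (@lebesgue_measure2 R).

Lemma measurable_strip_fst : measurable ([set z | 1 < `|z.1|] : set plane).
Proof.
rewrite [X in measurable X](_ : _ = (((Num.norm : R -> R) \o fst) @^-1` `]1, +oo[)); last first.
  by apply/seteqP; split => z; rewrite /= in_itv/= andbT.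
rewrite -[X in measurable X]setTI.
have mf : measurable_fun setT ((Num.norm : R -> R) \o fst : plane -> R).
  by apply: measurableT_comp => //; exact: normr_measurable.
by apply: mf => //; exact: measurable_itv.
Qed.

Lemma measurable_strip_snd : measurable ([set z | 1 < `|z.2|] : set plane).
Proof.
rewrite [X in measurable X](_ : _ = (((Num.norm : R -> R) \o snd) @^-1` `]1, +oo[)); last first.
  by apply/seteqP; split => z; rewrite /= in_itv/= andbT.
rewrite -[X in measurable X]setTI.
have mf : measurable_fun setT ((Num.norm : R -> R) \o snd : plane -> R).
  by apply: measurableT_comp => //; exact: normr_measurable.
by apply: mf => //; exact: measurable_itv.
Qed.

(** [B] is the area of the right cap, and [A] the excess over [2] of the
    integral of the slices on [[0, 1]]; [area_split] identifies it with the area of the top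
    cap. *)
Lemma moment_bound (K : set (R * R)) : between_square_and_diamond K ->
  let B := area (K `&` [set z | 1 < `|z.1|]) / 2 in
  let A := area K / 2 - 2 - B in
  [/\ 0 <= A <= 1, 0 <= B <= 1 &
  \int[leb2]_(z in K) z.1 ^+ 2 <=
    4 / 3 + 2 / 3 * A - A ^+ 2 / 3 + 2 * B + 4 / 3 * B ^+ 2 + B ^+ 3 / 3].
Proof.
move=> HK.
have mK := bsd_measurable HK.
have mS := measurable_slice mK.
have le01 : 0 <= 1 :> R by lra.
have le12 : 1 <= 2 :> R by lra.
have split_slice (f : R -> R) (M : R) : measurable_fun setT f ->
    (forall x, x \in `[(0 : R), 2] -> `|f x| <= M) ->
    \int[leb]_(x in `[0%R : R, 2]) (f x * slice K x) =
    \int[leb]_(x in `[0%R : R, 1]) (f x * slice K x) +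
    \int[leb]_(x in `[1%R : R, 2]) (f x * slice K x).
  move=> mf fM; apply: Rintegral_itv_split => //.
  exact: (@integrable_sliceM _ _ HK _ _ _ M).
pose E : set R := [set x | 1 < `|x|].
have mE : measurable (E : set line).
  rewrite [X in measurable X](_ : _ = ((Num.norm : R -> R) @^-1` `]1, +oo[)); last first.
    by apply/seteqP; split => z; rewrite /= in_itv/= andbT.
  rewrite -[X in measurable X]setTI.
  by apply: normr_measurable => //; exact: measurable_itv.
have integrable12 (f : R -> R) : measurable_fun setT f -> (forall x, `|f x| <= 1) ->
    leb.-integrable `]1%R : R, 2] (EFin \o (fun x => f x * slice K x)).
  move=> mf f1; apply: (@integrableS _ _ _ _ (`[1%R, 2] : set line)) => //.
  - by apply: subset_itv; rewrite bnd_simp.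
  - exact: (@integrable_sliceM _ _ HK _ _ _ 1).
have IB : area (K `&` [set z | 1 < `|z.1|]) =
    2 * \int[leb]_(x in `[1%R : R, 2]) slice K x.
  transitivity (\int[leb2]_(z in K) (\1_E : R -> R) z.1).
    rewrite /Rintegral /area; congr fine; apply/esym.
    rewrite setIC; exact: (integral_indic leb2 mK measurable_strip_fst).
  rewrite (@Rintegral_even _ _ HK \1_E 1).
  - rewrite (split_slice \1_E 1).
    + congr (2 * _); rewrite (@eq_Rintegral _ _ _ leb _ (cst 0)); last first.
        move=> x; rewrite inE/= in_itv/= => /andP[x0 x1].
        rewrite indicE memNset ?mul0r// /E/= => /lt_geF.
        by rewrite ger0_norm// x1.
      rewrite Rintegral_cst ?mul0r ?add0r; last exact: measurable_itv.
      rewrite -[RHS]Rintegral_itv_obnd_cbnd; last first.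
        have := integrable12 (cst 1); rewrite [X in EFin \o X](_ : _ = slice K).
          by apply => // x; rewrite normr1.
        by apply/funext => x; rewrite /= mul1r.
      rewrite -[LHS]Rintegral_itv_obnd_cbnd; last first.
        apply: (integrable12 \1_E); first exact: measurable_indic.
        by move=> x; rewrite indicE; case: (_ \in _); rewrite ?normr0 ?normr1.
      apply: eq_Rintegral => x; rewrite inE/= in_itv/= => /andP[x1 _].
      by rewrite indicE mem_set ?mul1r// /E/= gtr0_norm//; lra.
    + exact: measurable_indic.
    + by move=> x _; rewrite indicE; case: (_ \in _); rewrite ?normr0 ?normr1.
  - exact: measurable_indic.
  - by [].
  - by move=> x; rewrite !indicE; congr (_%:R); congr nat_of_bool; apply/idP/idP;
    rewrite !inE /E/= normrN.
  - by move=> x _; rewrite indicE; case: (_ \in _) => /=.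
have IA : area K = 2 * (\int[leb]_(x in `[0%R : R, 1]) slice K x +
    \int[leb]_(x in `[1%R : R, 2]) slice K x).
  transitivity (\int[leb2]_(z in K) (cst 1 : R -> R) z.1).
    by rewrite [RHS](@Rintegral_cst _ _ _ leb2 K mK) mul1r.
  rewrite (@Rintegral_even _ _ HK (cst 1) 1)//.
  rewrite (split_slice (cst 1) 1)//; last by move=> x _; rewrite normr1.
  by congr (_ * (_ + _)); apply: eq_Rintegral => x _; rewrite mul1r.
have -> : \int[leb2]_(z in K) z.1 ^+ 2 =
    2 * (\int[leb]_(x in `[0%R : R, 1]) (x ^+ 2 * slice K x) +
    \int[leb]_(x in `[1%R : R, 2]) (x ^+ 2 * slice K x)).
  rewrite (@Rintegral_even _ _ HK (fun x => x ^+ 2) 4)//.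
  - rewrite (split_slice (fun x => x ^+ 2) 4)//.
    by move=> x; rewrite in_itv/= ger0_norm ?sqr_ge0//; nra.
  - by move=> x; exact: sqr_ge0.
  - by move=> x; rewrite sqrrN.
  - by move=> x; rewrite -[x ^+ 2]real_normK ?num_real//; have := normr_ge0 x; nra.
move=> B A.
have BE : \int[leb]_(x in `[1%R : R, 2]) slice K x = B by rewrite /B IB; field.
have AE : \int[leb]_(x in `[0%R : R, 1]) slice K x = 2 + A by rewrite /A IA BE; field.
have [|||A0 A1 MA] := @inner_profile _ (slice K) A _ _ _ AE.
- exact: measurable_funTS.
- move=> x /andP[x0 x1]; rewrite slice_ge2 ?ger0_norm//=.
  by apply: slice_le => //; lra.
- by move=> x y x0 xy y1; exact: slice_noninc.
have [|||B0 B1 MB] := @outer_profile _ (slice K) B _ _ _ BE.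
- exact: measurable_funTS.
- move=> x /andP[x1 x2]; rewrite slice_ge0/=.
  by apply: slice_le => //; lra.
- by move=> x y x0 xy y1; exact: slice_outer.
by split; [rewrite A0|rewrite B0|lra].
Qed.

(** The caps [1 < |u|] and [1 < |v|] are disjoint because they lie in the
    diamond. *)
Lemma area_split (K : set (R * R)) : between_square_and_diamond K ->
  area K = 4 + area (K `&` [set z | 1 < `|z.1|]) + area (K `&` [set z | 1 < `|z.2|]).
Proof.
move=> HK; have mK := bsd_measurable HK.
pose S : set plane := `[(-1)%R, 1]%classic `*` `[(-1)%R, 1]%classic.
have mS : measurable S by apply: measurableX; exact: measurable_itv.
have SE : leb2 S = 4%:E.
  rewrite [leb2 _]product_measure1E//= lebesgue_measure_itv/= lte_fin.
  by rewrite ifT; [rewrite -!EFinB -EFinM; congr EFin; ring|lra].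
pose E1 : set plane := K `&` [set z | 1 < `|z.1|].
pose E2 : set plane := K `&` [set z | 1 < `|z.2|].
have mE1 : measurable E1 by apply: measurableI => //; exact: measurable_strip_fst.
have mE2 : measurable E2 by apply: measurableI => //; exact: measurable_strip_snd.
have fin (E : set plane) : measurable E -> E `<=` K -> leb2 E \is a fin_num.
  move=> mE EK; rewrite ge0_fin_numE//; apply: leb2_box_lty => //.
  by move=> z /EK; exact: bsd_box.
have KE : K = (S `|` E1) `|` E2.
  apply/seteqP; split => [[u v] Kuv|[u v] [[[/= + +]|[]//]|[]//]]; last first.
    by rewrite !in_itv/= -!ler_norml; exact: (bsd_square HK).
  case: (ltP 1 `|u|) => u1; first by left; right.
  case: (ltP 1 `|v|) => v1; first by right.
  by left; left; split; rewrite /= in_itv/= -ler_norml.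
have d1 : S `&` E1 = set0.
  rewrite -subset0 => -[u v] [[/= + _] [_ /=]].
  by rewrite in_itv/= -ler_norml leNgt => /negP.
have d2 : (S `|` E1) `&` E2 = set0.
  rewrite -subset0 => -[u v] [[[/= _ +]|[Kuv /= u1]] [_ /= v1]].
    by rewrite in_itv/= -ler_norml leNgt v1.
  by have := bsd_diamond HK Kuv; rewrite leNgt => /negP; apply; lra.
have fS : leb2 S \is a fin_num by rewrite SE.
have f1 : leb2 E1 \is a fin_num by apply: fin => //; exact: subIsetl.
have f2 : leb2 E2 \is a fin_num by apply: fin => //; exact: subIsetl.
rewrite {1}/area {1}KE [X in fine X](@measureU _ _ _ leb2)//; last exact: measurableU.
rewrite fineD; [|by apply: fin; [exact: measurableU|rewrite [X in _ `<=` X]KE;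
  exact: subsetUl]|exact: f2].
rewrite [X in fine X + _](@measureU _ _ _ leb2)//.
rewrite fineD; [|exact: fS|exact: f1].
by congr (_ + _ + _); exact: (congr1 fine SE).
Qed.

End moments_of_inscribed.

(** * Moments of order at most two *)

Section quadratic_moments.
Variable R : realType.
Local Notation line := (measurableTypeR R).
Local Notation plane := (line * line)%type.
Local Notation leb := (@lebesgue_measure R).
Local Notation leb2 := (@lebesgue_measure2 R).
Implicit Types (K : set (R * R)).

Lemma measurable_quadratic (p q r s t : R) : measurable_fun setT
  (fun z : plane => p * z.1 ^+ 2 + q * (z.1 * z.2) + r * z.2 ^+ 2
    + s * z.1 + t * z.2 : R).
Proof.
have m1 : measurable_fun setT (fun z : plane => z.1 : R) by exact: measurable_fst.
have m2 : measurable_fun setT (fun z : plane => z.2 : R) by exact: measurable_snd.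
do ?apply: measurable_funD; apply: measurable_funM => //;
  solve [exact: measurable_funX|exact: measurable_funM].
Qed.

Lemma integrable_quadratic K (p q r s t : R) :
  measurable (K : set plane) -> K `<=` @box R ->
  leb2.-integrable K (EFin \o (fun z : plane =>
    p * z.1 ^+ 2 + q * (z.1 * z.2) + r * z.2 ^+ 2 + s * z.1 + t * z.2)).
Proof.
move=> mK Kb.
apply: (@integrable_box _ _ _ (`|p| * 4 + `|q| * 4 + `|r| * 4 + `|s| * 2 + `|t| * 2)) => //.
  exact: measurable_quadratic.
move=> [u v] [/=]; rewrite !in_itv/= -!ler_norml => u2 v2.
have u0 := normr_ge0 u; have v0 := normr_ge0 v.
apply: (le_trans (ler_normD _ _)); apply: lerD; last by rewrite normrM ler_wpM2l.
apply: (le_trans (ler_normD _ _)); apply: lerD; last by rewrite normrM ler_wpM2l.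
apply: (le_trans (ler_normD _ _)); apply: lerD; last first.
  by rewrite normrM normrX ler_wpM2l//; nra.
apply: (le_trans (ler_normD _ _)); apply: lerD.
  by rewrite normrM normrX ler_wpM2l//; nra.
by rewrite !normrM ler_wpM2l//; nra.
Qed.

Definition moment K (f : R * R -> R) : R := \int[leb2]_(z in K) f z.

Lemma moment_quadratic K (p q r s t : R) :
  measurable (K : set plane) -> K `<=` @box R ->
  moment K (fun z =>
    p * z.1 ^+ 2 + q * (z.1 * z.2) + r * z.2 ^+ 2 + s * z.1 + t * z.2) =
  p * moment K (fun z => z.1 ^+ 2) + q * moment K (fun z => z.1 * z.2) +
  r * moment K (fun z => z.2 ^+ 2) + s * moment K fst + t * moment K snd.
Proof.
move=> mK Kb.
have iq p' q' r' s' t' (f : plane -> R) :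
    f =1 (fun z : plane => p' * z.1 ^+ 2 + q' * (z.1 * z.2) + r' * z.2 ^+ 2
      + s' * z.1 + t' * z.2) -> leb2.-integrable K (EFin \o f).
  by move=> /funext ->; exact: integrable_quadratic.
rewrite /moment RintegralD//; last 2 first.
- by apply: (iq p q r s 0) => z; ring.
- by apply: (iq 0 0 0 0 t) => z; ring.
rewrite RintegralD//; last 2 first.
- by apply: (iq p q r 0 0) => z; ring.
- by apply: (iq 0 0 0 s 0) => z; ring.
rewrite RintegralD//; last 2 first.
- by apply: (iq p q 0 0 0) => z; ring.
- by apply: (iq 0 0 r 0 0) => z; ring.
rewrite RintegralD//; last 2 first.
- by apply: (iq p 0 0 0 0) => z; ring.
- by apply: (iq 0 q 0 0 0) => z; ring.
rewrite !RintegralZl//.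
- by apply: (iq 0 0 0 0 1) => z; ring.
- by apply: (iq 0 0 0 1 0) => z; ring.
- by apply: (iq 0 0 1 0 0) => z; ring.
- by apply: (iq 0 1 0 0 0) => z; ring.
- by apply: (iq 1 0 0 0 0) => z; ring.
Qed.

Lemma moment_linear K (a b c d : R) (p q r s t : R) :
  measurable (K : set plane) -> a * d - b * c != 0 ->
  let phi := fun z : R * R => (a * z.1 + b * z.2, c * z.1 + d * z.2) in
  let f := fun z : R * R =>
    p * z.1 ^+ 2 + q * (z.1 * z.2) + r * z.2 ^+ 2 + s * z.1 + t * z.2 in
  phi @^-1` K `<=` @box R ->
  moment K f = `|a * d - b * c| * moment (phi @^-1` K) (f \o phi).
Proof.
move=> mK D0 phi f Kb.
have sphi := linear_scales_area D0.
have mpre : measurable (phi @^-1` K : set plane).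
  by rewrite -[X in measurable X]setTI; case: sphi => mphi _ _; exact: mphi.
rewrite /moment (integral_scales_area sphi)//; first exact: measurable_quadratic.
have := integrable_quadratic
  (p * a ^+ 2 + q * a * c + r * c ^+ 2)
  (p * 2 * a * b + q * (a * d + b * c) + r * 2 * c * d)
  (p * b ^+ 2 + q * b * d + r * d ^+ 2)
  (s * a + t * c) (s * b + t * d) mpre Kb.
by congr (integrable _ _ (_ \o _)); apply/funext => z; rewrite /f /phi /=; ring.
Qed.

Lemma area_linear K (a b c d : R) :
  measurable (K : set plane) -> a * d - b * c != 0 ->
  let phi := fun z : R * R => (a * z.1 + b * z.2, c * z.1 + d * z.2) in
  phi @^-1` K `<=` @box R ->
  area K = `|a * d - b * c| * area (phi @^-1` K).
Proof.
move=> mK D0 phi Kb; have [mphi c0 phiE] := linear_scales_area D0.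
have mpre : measurable (phi @^-1` K : set plane).
  by rewrite -[X in measurable X]setTI; exact: mphi.
rewrite /area -phiE// fineM// ge0_fin_numE//.
exact: leb2_box_lty.
Qed.

End quadratic_moments.

(** * Linear invariance *)

Section affine_invariance.
Variable R : realType.
Local Notation line := (measurableTypeR R).
Local Notation plane := (line * line)%type.
Local Notation leb2 := (@lebesgue_measure2 R).
Implicit Types (K : set (R * R)).

Lemma det_CovE K :
  \det (Cov K) =
  (average K (fun z => z.1 ^+ 2) - average K fst ^+ 2) *
  (average K (fun z => z.2 ^+ 2) - average K snd ^+ 2) -
  (average K (fun z => z.1 * z.2) - average K fst * average K snd) ^+ 2.
Proof.
rewrite (expand_det_row _ ord0) big_ord_recl big_ord1 /cofactor !det_mx11 !mxE.
rewrite /coord2 /= !expr0 !mul1r.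
set a12 := average K (fun x => x.2 * x.1).
have -> : a12 = average K (fun z => z.1 * z.2).
  by rewrite /a12; congr average; apply/funext => z; rewrite mulrC.
ring.
Qed.

(** The Jacobian factors of the integral and of the area cancel, so that second
    and first moments change by the substitution alone. *)
Lemma average_linear K (a b c d : R) (p q r s t : R) :
  measurable (K : set plane) -> a * d - b * c != 0 ->
  let phi := fun z : R * R => (a * z.1 + b * z.2, c * z.1 + d * z.2) in
  let K' := phi @^-1` K in
  K' `<=` @box R ->
  average K (fun z : R * R =>
    p * z.1 ^+ 2 + q * (z.1 * z.2) + r * z.2 ^+ 2 + s * z.1 + t * z.2) =
  (p * a ^+ 2 + q * a * c + r * c ^+ 2) * average K' (fun z => z.1 ^+ 2) +
  (p * 2 * a * b + q * (a * d + b * c) + r * 2 * c * d) *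
     average K' (fun z => z.1 * z.2) +
  (p * b ^+ 2 + q * b * d + r * d ^+ 2) * average K' (fun z => z.2 ^+ 2) +
  (s * a + t * c) * average K' fst + (s * b + t * d) * average K' snd.
Proof.
move=> mK D0 phi K' Kb; have mK' : measurable (K' : set plane).
  have [mphi _ _] := linear_scales_area D0.
  by rewrite -[X in measurable X]setTI; exact: mphi.
rewrite /average -!/(moment _ _).
have := @moment_linear _ K a b c d p q r s t mK D0 Kb.
rewrite /= -/phi -/K' => ->.
have := @area_linear _ K a b c d mK D0 Kb.
rewrite /= -/phi -/K' => ->.
have nD0 : `|a * d - b * c| != 0 by rewrite normr_eq0.
rewrite -mulf_div divff// mul1r.
rewrite (_ : _ \o phi = fun z : R * R =>
  (p * a ^+ 2 + q * a * c + r * c ^+ 2) * z.1 ^+ 2 +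
  (p * 2 * a * b + q * (a * d + b * c) + r * 2 * c * d) * (z.1 * z.2) +
  (p * b ^+ 2 + q * b * d + r * d ^+ 2) * z.2 ^+ 2 +
  (s * a + t * c) * z.1 + (s * b + t * d) * z.2); last first.
  by apply/funext => z; rewrite /= /phi/=; ring.
by rewrite moment_quadratic// !mulrDl !mulrA.
Qed.

(** The covariance matrix changes by congruence, which multiplies its
    determinant by the square of that of the map, as it does for
    [area K ^+ 2]. *)
Lemma calC_linear K (a b c d : R) :
  measurable (K : set plane) -> a * d - b * c != 0 ->
  let phi := fun z : R * R => (a * z.1 + b * z.2, c * z.1 + d * z.2) in
  phi @^-1` K `<=` @box R -> calC K = calC (phi @^-1` K).
Proof.
move=> mK D0 phi Kb.
have av := fun p q r s t => @average_linear K a b c d p q r s t mK D0 Kb.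
have quad (p q r s t : R) (f : R * R -> R) :
    f =1 (fun z => p * z.1 ^+ 2 + q * (z.1 * z.2) + r * z.2 ^+ 2 + s * z.1 + t * z.2) ->
    average K f = average K (fun z : R * R =>
      p * z.1 ^+ 2 + q * (z.1 * z.2) + r * z.2 ^+ 2 + s * z.1 + t * z.2).
  by move=> /funext ->.
rewrite /calC !det_CovE.
rewrite (quad 1 0 0 0 0 (fun z => z.1 ^+ 2)) => [|z]; last by ring.
rewrite (quad 0 0 1 0 0 (fun z => z.2 ^+ 2)) => [|z]; last by ring.
rewrite (quad 0 1 0 0 0 (fun z => z.1 * z.2)) => [|z]; last by ring.
rewrite (quad 0 0 0 1 0 fst) => [|z]; last by ring.
rewrite (quad 0 0 0 0 1 snd) => [|z]; last by ring.
rewrite !av /= -/phi.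
have -> : area K = `|a * d - b * c| * area (phi @^-1` K) by exact: area_linear.
set A := area _; set x := average _ _; set y := average _ _.
set u := average _ _; set v := average _ _; set w := average _ _.
rewrite exprMn real_normK ?num_real//.
rewrite [X in _ / X](_ : _ =
  (a * d - b * c) ^+ 2 * ((x - v ^+ 2) * (u - w ^+ 2) - (y - v * w) ^+ 2)); last by ring.
by rewrite -mulf_div divff ?mul1r// ?expf_eq0//.
Qed.

End affine_invariance.

(** * The square *)

Section extremal_bound.
Variable R : realType.
Local Notation line := (measurableTypeR R).
Local Notation plane := (line * line)%type.
Local Notation leb := (@lebesgue_measure R).
Local Notation leb2 := (@lebesgue_measure2 R).
Implicit Types (K : set (R * R)).

Definition unit_square : set (R * R) := `[-1, 1]%classic `*` `[-1, 1]%classic.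

Lemma measurable_unit_square : measurable (unit_square : set plane).
Proof. by apply: measurableX; exact: measurable_itv. Qed.

Lemma unit_square_box : unit_square `<=` @box R.
Proof. by move=> [u v] [/=]; rewrite !in_itv/= => ? ?; split; rewrite /= in_itv/=; lra. Qed.

Lemma eq_average K (f g : R * R -> R) : f =1 g -> average K f = average K g.
Proof. by move=> /funext ->. Qed.

Lemma average_swap K : measurable (K : set plane) ->
  (fun z => (z.2, z.1)) @^-1` K `<=` @box R ->
  average K (fun z => z.2 ^+ 2) =
  average ((fun z : R * R => (z.2, z.1)) @^-1` K) (fun z => z.1 ^+ 2).
Proof.
move=> mK Kb.
have D0 : 0 * 0 - 1 * 1 != 0 :> R by rewrite mul0r mulr1 sub0r oppr_eq0 oner_neq0.
have E : (fun z : R * R => (0 * z.1 + 1 * z.2, 1 * z.1 + 0 * z.2)) = fun z => (z.2, z.1).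
  by apply/funext => z; congr pair; ring.
have := @average_linear R K 0 1 1 0 0 0 1 0 0 mK D0; rewrite /= E => /(_ Kb).
rewrite (@eq_average _ _ (fun z => z.2 ^+ 2)); last by move=> z; ring.
by move=> ->; ring.
Qed.

(** The reflection through the origin preserves [K] and changes the sign of the
    coordinates. *)
Lemma average_odd K : measurable (K : set plane) -> K `<=` @box R ->
  (forall u v, K (u, v) -> K (- u, - v)) ->
  average K fst = 0 /\ average K snd = 0.
Proof.
move=> mK Kb KN.
have D0 : (-1) * (-1) - 0 * 0 != 0 :> R by rewrite mulr0 subr0 mulrNN mulr1 oner_neq0.
have E : (fun z : R * R => ((-1) * z.1 + 0 * z.2, 0 * z.1 + (-1) * z.2)) =
  fun z => (- z.1, - z.2).
  by apply/funext => z; congr pair; ring.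
have KE : (fun z : R * R => (- z.1, - z.2)) @^-1` K = K.
  apply/seteqP; split => -[u v]; last exact: KN.
  by move=> /KN; rewrite /= !opprK.
have av p q r s t := @average_linear R K (-1) 0 0 (-1) p q r s t mK D0.
move: av; rewrite /= E KE => av; split.
- have := av 0 0 0 1 0 Kb.
  rewrite (@eq_average _ _ fst); last by move=> z; ring.
  by move=> H; lra.
- have := av 0 0 0 0 1 Kb.
  rewrite (@eq_average _ _ snd); last by move=> z; ring.
  by move=> H; lra.
Qed.

Lemma area_unit_square : area unit_square = 4.
Proof.
rewrite /area [lebesgue_measure2 _]product_measure1E//= lebesgue_measure_itv/= lte_fin.
by rewrite ifT; [rewrite -!EFinB -EFinM /=; ring|lra].
Qed.

Lemma average_unit_square : average unit_square (fun z => z.1 ^+ 2) = 1 / 3.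
Proof.
rewrite /average area_unit_square.
have mI : measurable (`[(-1)%R, 1]%classic : set line) by exact: measurable_itv.
have -> : \int[leb2]_(z in unit_square) z.1 ^+ 2 = 4 / 3; last by field.
rewrite -[X in Rintegral _ X _](_ : unit_square `&` fst @^-1` `[(-1)%R, 1]%classic = _); last first.
  by apply: setIidl => -[u v] [].
rewrite (@Rintegral_slice _ unit_square _ (fun x => x ^+ 2))//; last 3 first.
- exact: measurable_unit_square.
- exact: unit_square_box.
- by move=> x; exact: sqr_ge0.
rewrite (@eq_Rintegral _ _ _ leb _ (fun x => 0 + 0 * x + 2 * x ^+ 2 + 0 * x ^+ 3)).
  by rewrite Rintegral_cubic; [field|lra].
move=> x /[!inE] xI; rewrite /slice /unit_square in_xsectionX ?inE//.
rewrite lebesgue_measure_itv/= lte_fin ifT; last by lra.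
by rewrite -EFinB /=; ring.
Qed.

Lemma unit_square_moments :
  [/\ average unit_square (fun z => z.1 ^+ 2) = 1 / 3,
      average unit_square (fun z => z.2 ^+ 2) = 1 / 3,
      average unit_square (fun z => z.1 * z.2) = 0,
      average unit_square fst = 0 & average unit_square snd = 0].
Proof.
have mS := measurable_unit_square; have Sb := unit_square_box.
have sw : (fun z : R * R => (z.2, z.1)) @^-1` unit_square = unit_square.
  by apply/seteqP; split => -[u v] [].
have [] := @average_odd unit_square mS Sb.
  by move=> u v [/=]; rewrite !in_itv/= => ? ?; split; rewrite /= in_itv/=; lra.
move=> -> ->; split => //.
- exact: average_unit_square.
- by rewrite average_swap// sw//; exact: average_unit_square.
have D0 : (-1) * 1 - 0 * 0 != 0 :> R by rewrite mulr0 subr0 mulr1 oppr_eq0 oner_neq0.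
have E : (fun z : R * R => ((-1) * z.1 + 0 * z.2, 0 * z.1 + 1 * z.2)) =
  fun z => (- z.1, z.2).
  by apply/funext => z; congr pair; ring.
have KE : (fun z : R * R => (- z.1, z.2)) @^-1` unit_square = unit_square.
  by apply/seteqP; split => -[u v] [/=]; rewrite !in_itv/= => ? ?; split;
    rewrite /= in_itv/=; lra.
have := @average_linear R unit_square (-1) 0 0 1 0 1 0 0 0 mS D0.
rewrite /= E KE => /(_ Sb).
rewrite (@eq_average _ _ (fun z => z.1 * z.2)); last by move=> z; ring.
by move=> H; lra.
Qed.

Lemma calC_unit_square : calC unit_square = 144.
Proof.
rewrite /calC det_CovE area_unit_square.
have [-> -> -> -> ->] := unit_square_moments.
by field.
Qed.

End extremal_bound.

(** * The bound in normal position *)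

Section normalized_bound.
Variable R : realType.
Local Notation line := (measurableTypeR R).
Local Notation plane := (line * line)%type.
Local Notation leb := (@lebesgue_measure R).
Local Notation leb2 := (@lebesgue_measure2 R).
Implicit Types (K : set (R * R)).

Lemma continuous_linear_plane (a b c d : R) :
  continuous (fun z : R * R => (a * z.1 + b * z.2, c * z.1 + d * z.2)).
Proof.
have form (p q : R) : continuous (fun z : R * R => p * z.1 + q * z.2).
  move=> z; apply: cvgD; apply: cvgMr; [exact: cvg_fst|exact: cvg_snd].
move=> z; exact: (@cvg_pair _ _ _ _ _ _ _ _ _ _ _ (form a b z) (form c d z)).
Qed.

Lemma bsd_swap K : between_square_and_diamond K ->
  between_square_and_diamond ((fun z => (z.2, z.1)) @^-1` K).
Proof.
case=> cK convK sK sqK dK; split.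
- apply: preimage_closed; last exact: cK.
  move=> z _; refine (@cvg_pair _ _ _ _ _ _ _ _ _ snd fst cvg_snd cvg_fst).
- by move=> t u v u' v' t01 /= *; exact: convK.
- by move=> u v; exact: sK.
- by move=> u v u1 v1; exact: sqK.
- by move=> u v /= /dK; rewrite addrC.
Qed.

Lemma area_swap K : measurable (K : set plane) ->
  (fun z => (z.2, z.1)) @^-1` K `<=` @box R ->
  area ((fun z : R * R => (z.2, z.1)) @^-1` K) = area K.
Proof.
move=> mK Kb.
have D0 : 0 * 0 - 1 * 1 != 0 :> R by rewrite mul0r mulr1 sub0r oppr_eq0 oner_neq0.
have E : (fun z : R * R => (0 * z.1 + 1 * z.2, 1 * z.1 + 0 * z.2)) = fun z => (z.2, z.1).
  by apply/funext => z; congr pair; ring.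
have := @area_linear R K 0 1 1 0 mK D0; rewrite /= E => /(_ Kb) ->.
by rewrite mul0r mulr1 sub0r normrN normr1 mul1r.
Qed.

(** Used for squares of linear forms: comparison with the square shows that the
    covariance matrix is definite. *)
Lemma moment_square_le K (f : R * R -> R) : between_square_and_diamond K ->
  measurable_fun setT (f : plane -> R) -> (forall z, 0 <= f z) ->
  leb2.-integrable K (EFin \o f) ->
  moment (@unit_square R) f <= moment K f.
Proof.
move=> HK mf f0 if_.
have mK := bsd_measurable HK.
have mS := @measurable_unit_square R.
have SK : @unit_square R `<=` K.
  by move=> [u v] [/=]; rewrite !in_itv/= -!ler_norml; exact: (bsd_square HK).
rewrite /moment /Rintegral fine_le//.
- by apply: integrable_fin_num => //; exact: integrableS if_.
- exact: integrable_fin_num.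
- apply: ge0_subset_integral => //.
  + by apply/measurable_EFinP; exact: measurable_funTS.
  + by move=> z _; rewrite lee_fin.
Qed.

(** The mixed moment only decreases the determinant of the covariance matrix.
    The second diagonal entry is handled by exchanging the coordinates, which
    exchanges the two pairs of caps. *)
Lemma bsd_calC K : between_square_and_diamond K -> 144 <= calC K.
Proof.
move=> HK; have mK := bsd_measurable HK; have Kb := bsd_box HK.
have HK' := bsd_swap HK; have mK' := bsd_measurable HK'; have Kb' := bsd_box HK'.
rewrite /calC det_CovE.
have [-> ->] := average_odd mK Kb (bsd_symmetric HK).
rewrite expr0n/= !subr0 mulr0 subr0.
pose M11 := moment K (fun z => z.1 ^+ 2).
pose M12 := moment K (fun z => z.1 * z.2).
pose M22 := moment K (fun z => z.2 ^+ 2).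
rewrite /average -/(moment K (fun z => z.1 ^+ 2)) -/(moment K (fun z => z.2 ^+ 2))
  -/(moment K (fun z => z.1 * z.2)) -/M11 -/M12 -/M22.
(* The square already makes the second moments a positive definite form, so
   that dividing by the determinant is harmless. *)
have pos s t : 4 / 3 * (s ^+ 2 + t ^+ 2) <= s ^+ 2 * M11 + 2 * s * t * M12 + t ^+ 2 * M22.
  have E : (fun z : R * R => s ^+ 2 * z.1 ^+ 2 + 2 * s * t * (z.1 * z.2) + t ^+ 2 * z.2 ^+ 2
    + 0 * z.1 + 0 * z.2) = fun z => (s * z.1 + t * z.2) ^+ 2.
    by apply/funext => z; ring.
  have := moment_quadratic (s ^+ 2) (2 * s * t) (t ^+ 2) 0 0 mK Kb.
  rewrite !mul0r !addr0 -/M11 -/M12 -/M22 => <-.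
  apply: le_trans (moment_square_le HK (measurable_quadratic _ _ _ _ _)
    _ (integrable_quadratic _ _ _ _ _ mK Kb)); last first.
    by move=> z; rewrite (congr1 (fun f => f z) E); exact: sqr_ge0.
  rewrite moment_quadratic//; [|exact: measurable_unit_square|exact: unit_square_box].
  have mE f : moment (@unit_square R) f = 4 * average (@unit_square R) f.
    by rewrite /average area_unit_square mulrC divfK ?pnatr_eq0.
  rewrite !mE; have [-> -> -> -> ->] := unit_square_moments R; lra.
have M11_gt0 : 0 < M11 by have := pos 1 0; lra.
have M22_gt0 : 0 < M22 by have := pos 0 1; lra.
(* The vector [(M22, - M12)] extracts the determinant from the form. *)
have det_gt0 : 0 < M11 * M22 - M12 ^+ 2.
  rewrite -(pmulr_rgt0 _ M22_gt0); have := pos M22 (- M12).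
  have : 0 < M22 ^+ 2 by exact: exprn_gt0.
  have := sqr_ge0 M12; lra.
have S0 : 0 < area K.
  by have [/andP[A0 _] /andP[B0 _] _] := moment_bound HK; lra.
have [] := moment_bound HK; have [] := moment_bound HK'.
rewrite (area_swap mK Kb').
set B := area (K `&` _) / 2; set A := area K / 2 - 2 - B.
have -> : area ((fun z : R * R => (z.2, z.1)) @^-1` K `&` [set z | 1 < `|z.1|]) / 2 = A.
  have <- : area ((fun z : R * R => (z.2, z.1)) @^-1` (K `&` [set z | 1 < `|z.2|])) =
            area ((fun z : R * R => (z.2, z.1)) @^-1` K `&` [set z | 1 < `|z.1|]) by [].
  rewrite area_swap; last 2 first.
  - by apply: measurableI => //; exact: measurable_strip_snd.
  - by move=> z [/= Kz _]; exact: Kb'.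
  by rewrite /A /B (area_split HK); field.
rewrite (_ : area K / 2 - 2 - A = B); last by rewrite /A; ring.
have -> : \int[leb2]_(z in (fun z : R * R => (z.2, z.1)) @^-1` K) z.1 ^+ 2 = M22.
  have := average_swap mK Kb'; rewrite /average (area_swap mK Kb').
  by move/(mulIf (invr_neq0 (lt0r_neq0 S0))) => <-.
rewrite -/(moment K (fun z => z.1 ^+ 2)) -/M11.
have areaE : area K = 2 * (2 + A + B) by rewrite /A; field.
move=> /andP[B0 B1] /andP[A0 A1] m22 _ _ m11.
have P := cap_area_inequality A0 A1 B0 B1.
have Mprod : M11 * M22 <= (2 + A + B) ^+ 4 / 9.
  rewrite -[leRHS]mul1r; apply: (@le_trans _ _ ((
    (4 + 6 * B + 4 * B ^+ 2 + B ^+ 3 + 2 * A - A ^+ 2) / 3) *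
    ((4 + 6 * A + 4 * A ^+ 2 + A ^+ 3 + 2 * B - B ^+ 2) / 3))).
    by apply: ler_pM; lra.
  by lra.
rewrite (_ : _ / _ * _ - _ = (M11 * M22 - M12 ^+ 2) / area K ^+ 2); last first.
  by field; rewrite gt_eqF.
rewrite invf_div mulrA -exprD ler_pdivlMr// areaE.
by have := sqr_ge0 M12; lra.
Qed.

End normalized_bound.

(** * Reaching the normal position *)

Section normal_position.
Variable R : realType.
Local Notation line := (measurableTypeR R).
Local Notation plane := (line * line)%type.
Implicit Types (K : set (R * R)).

Lemma convex_set_segment (E : lmodType R) (A : set E) (t : R) (x y : E) :
  @convex_set R E A -> 0 <= t <= 1 -> A x -> A y -> A (t *: x + (1 - t) *: y).
Proof.
move=> cA /andP[t0 t1] Ax Ay.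
by have := cA x y (Itv01 t0 t1); rewrite !inE => /(_ Ax Ay).
Qed.

Let cross (x y : R * R) := x.1 * y.2 - x.2 * y.1.

(** The maximum is positive because [K] contains three points [p],
    [p + (h, 0)], [p + (0, h)], whose cross products cannot all vanish. *)
Lemma max_cross K : convex_body K ->
  exists x y, [/\ K x, K y, 0 < cross x y &
    forall x' y', K x' -> K y' -> cross x' y' <= cross x y].
Proof.
move=> [cK _ [p Kp]].
pose f (z : (R * R) * (R * R)) := cross z.1 z.2.
have cf : continuous f.
  have cfst (U V : topologicalType) : continuous (@fst U V).
    by move=> w; exact: cvg_fst.
  have csnd (U V : topologicalType) : continuous (@snd U V).
    by move=> w; exact: cvg_snd.
  move=> z.
  have c1 := continuous_comp (cfst _ _ z) (cfst _ _ z.1).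
  have c2 := continuous_comp (cfst _ _ z) (csnd _ _ z.1).
  have c3 := continuous_comp (csnd _ _ z) (cfst _ _ z.2).
  have c4 := continuous_comp (csnd _ _ z) (csnd _ _ z.2).
  by apply: cvgB; apply: cvgM; [exact: c1|exact: c4|exact: c2|exact: c3].
have KK0 : K `*` K !=set0 by exists (p, p); split; exact: interior_subset.
have [[x y] /[!inE] -[/= Kx Ky] xy_max] := compact_EVT_max KK0 (compact_setX cK cK)
  (continuous_subspaceT cf).
have {}xy_max x' y' : K x' -> K y' -> cross x' y' <= cross x y.
  by move=> Kx' Ky'; apply: (xy_max (x', y')); rewrite inE.
exists x, y; split => //; rewrite ltNge; apply/negP => xy_le0.
have zero x' y' : K x' -> K y' -> cross x' y' = 0.
  move=> Kx' Ky'; have := xy_max _ _ Kx' Ky'; have := xy_max _ _ Ky' Kx'.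
  by rewrite /cross in xy_le0 *; lra.
have /nbhs_ballP[e /= e0 eK] := Kp.
have h0 : 0 < e / 2 by rewrite divr_gt0.
have Kh : K (p.1 + e / 2, p.2).
  apply: eK; split; rewrite /ball/= ?subrr ?normr0// opprD addNKr normrN gtr0_norm//; lra.
have Kv : K (p.1, p.2 + e / 2).
  apply: eK; split; rewrite /ball/= ?subrr ?normr0// opprD addNKr normrN gtr0_norm//; lra.
have Kp' : K p by exact: interior_subset.
have := zero _ _ Kp' Kh; have := zero _ _ Kp' Kv; have := zero _ _ Kh Kv.
rewrite /cross /=; nra.
Qed.

(** The columns of the map are chosen so that [(1, 1)] goes to [x] and [(- 1, 1)]
    to [y].  The square is then the convex hull of the preimages of [x], [y],
    [- x] and [- y].  The maximality of the cross product, with [x] or [y] kept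
    fixed, bounds [u + v] and [v - u] by [2]; with the symmetry of [K], this is
    the diamond. *)
Lemma normal_position K : convex_body K -> symmetric_set K ->
  exists a b c d, a * d - b * c != 0 /\
    between_square_and_diamond
      ((fun z : R * R => (a * z.1 + b * z.2, c * z.1 + d * z.2)) @^-1` K).
Proof.
move=> bK sK; have [x [y [Kx Ky xy0 xy_max]]] := max_cross bK.
have [cK vK _] := bK.
have KN z : K z -> K (- z) by move=> Kz; rewrite sK; exists z.
pose a := (x.1 - y.1) / 2; pose b := (x.1 + y.1) / 2.
pose c := (x.2 - y.2) / 2; pose d := (x.2 + y.2) / 2.
pose phi := fun z : R * R => (a * z.1 + b * z.2, c * z.1 + d * z.2).
have D : a * d - b * c = cross x y / 2 by rewrite /a /b /c /d /cross; field.
have conv t u v u' v' : 0 <= t <= 1 -> K (phi (u, v)) -> K (phi (u', v')) ->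
    K (phi (t * u + (1 - t) * u', t * v + (1 - t) * v')).
  move=> t01 K1 K2; have := convex_set_segment vK t01 K1 K2.
  by congr K; rewrite /phi; congr pair; rewrite /= /GRing.scale/=; ring.
have sym u v : K (phi (u, v)) -> K (phi (- u, - v)).
  by move/KN; congr K; rewrite /phi; congr pair => /=; ring.
have Kpp : K (phi (1, 1)).
  by move: Kx; congr K; rewrite [x]surjective_pairing /phi/=;
    congr pair; rewrite /a /b /c /d; field.
have Kmp : K (phi (- 1, 1)).
  by move: Ky; congr K; rewrite [y]surjective_pairing /phi/=;
    congr pair; rewrite /a /b /c /d; field.
have Kmm : K (phi (- 1, - 1)) by exact: sym.
have Kpm : K (phi (1, - 1)) by rewrite -[1 in X in (X, _)]opprK; exact: sym.
exists a, b, c, d; split; first by rewrite D mulf_neq0// ?gt_eqF// invr_gt0.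
split; rewrite -/phi.
- apply: preimage_closed; first by move=> z _; exact: continuous_linear_plane.
  by apply: compact_closed => //; exact: norm_hausdorff.
- exact: conv.
- exact: sym.
- move=> u v; rewrite !ler_norml => u1 v1.
  have side w : K (phi (w, 1)) -> K (phi (w, - 1)) -> K (phi (w, v)).
    move=> K1 K2; have t01 : 0 <= (1 + v) / 2 <= 1 by lra.
    have := conv _ _ _ _ _ t01 K1 K2.
    by congr (K (phi (_, _))); field.
  have t01 : 0 <= (1 + u) / 2 <= 1 by lra.
  have := conv _ _ _ _ _ t01 (side _ Kpp Kpm) (side _ Kmp Kmm).
  by congr (K (phi (_, _))); field.
- have bound u v : K (phi (u, v)) -> u + v <= 2 /\ v - u <= 2.
    move=> Kuv; have := xy_max _ _ Kx Kuv; have := xy_max _ _ Kuv Ky.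
    have -> : cross (phi (u, v)) y = (u + v) * (cross x y / 2).
      by rewrite /cross /phi /a /b /c /d /=; field.
    have -> : cross x (phi (u, v)) = (v - u) * (cross x y / 2).
      by rewrite /cross /phi /a /b /c /d /=; field.
    by nra.
  move=> u v Kuv; have [] := bound _ _ Kuv; have [] := bound _ _ (sym _ _ Kuv).
  by case: (ger0P u) => ?; case: (ger0P v) => ?; lra.
Qed.

End normal_position.

Theorem theorem1p16 (R : realType) :
  (forall K : set (R * R),
     convex_body K -> symmetric_set K ->
     calC K >= calC (`[-1, 1]%classic `*` `[-1, 1]%classic : set (R * R))) /\
  calC (`[-1, 1]%classic `*` `[-1, 1]%classic : set (R * R)) = 144.
Proof.
have sq := calC_unit_square R; split => // K bK sK; rewrite [X in X <= _]sq.
have [a [b [c [d [D HK]]]]] := normal_position bK sK.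
have mK : measurable (K : set (measurableTypeR R * measurableTypeR R)).
  case: bK => cK _ _; apply: closed_measurable_plane.
  by apply: compact_closed => //; exact: norm_hausdorff.
by rewrite (calC_linear mK D (bsd_box HK)); exact: bsd_calC.
Qed.
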